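(* On a periodic domain $\Omega$, let smooth nodal solutions $\boldsymbol u_k(t)$ (with positive density and pressure) satisfy on every element $\Omega_k\in\mathcal T_h$ the entropy-split SBP-SAT discretization of the Euler equations $$\frac{d\boldsymbol{u}_k}{dt}+\frac{\beta}{\beta+1}\sum_{i=1}^{d}\overline{\mathsf D}_{x_ik}\boldsymbol f_k^{I(i)}+\frac{1}{\beta+1}\sum_{i=1}^{d}\tilde{\mathsf A}_{i}\overline{\mathsf D}_{x_ik}\boldsymbol w_k=\overline{\mathsf H}_k^{-1}\sum_{i=1}^{d}\overline{\mathsf E}_{x_ik}\boldsymbol f_k^{I(i)}-\frac12\overline{\mathsf H}_k^{-1}\sum_{g\in\Gamma_k^I}\sum_{i=1}^{d}\left[\overline{\mathsf E}_{x_i}^{kv}\circ\mathsf F_i(\boldsymbol u_k,\boldsymbol u_v)\right]\boldsymbol 1,$$ where $\Omega_v$ is the neighbour of $\Omega_k$ across $g$. Then the scheme is entropy conservative: $$\sum_{\Omega_k\in\mathcal T_h}\boldsymbol 1^T\mathsf H_k\frac{d\boldsymbol s_k}{dt}=0 ,$$ where $\boldsymbol s_k$ is the vector of values of Harten's entropy $\mathcal S$ at the nodes of $\Omega_k$.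
   Context: **Euler equations and Harten entropy.** Let $d\in\{1,2,3\}$, $\gamma=7/5$, $n_c=d+2$. Conservative variables: $\mathcal U=(\rho,\rho V_1,\dots,\rho V_d,e)^T$ with $\rho>0$, $p>0$, $e=p/(\gamma-1)+\tfrac12\rho V^TV$ (the symbol $p$ also denotes the polynomial degree of the operators). Inviscid fluxes: $\mathcal F^{I(i)}=(\rho V_i,\ \rho V_iV_1+\delta_{i1}p,\dots,\rho V_iV_d+\delta_{id}p,\ (e+p)V_i)^T$. Let $\alpha\in\mathbb R$ with $\alpha>0$ or $\alpha<-\gamma$ and $\beta=-(\gamma+\alpha)/(\gamma-1)$. Harten's entropy: $\mathcal S=\beta\rho(p\rho^{-\gamma})^{1/(\alpha+\gamma)}$; entropy variables $\mathcal W=(\partial\mathcal S/\partial\mathcal U)^T$, explicitly $\mathcal W^T=\frac{\rho}{p}(p\rho^{-\gamma})^{\frac1{\alpha+\gamma}}\left[-\frac{\alpha}{\gamma-1}\frac p\rho-\frac12V^TV,\ V^T,\ -1\right]$. The map $\mathcal U\mapsto\mathcal W$ is bijective onto its image, and $\tilde{\mathsf A}_i=\partial\mathcal F^{I(i)}/\partial\mathcal W$, which is symmetric. **Mesh and SBP operators.** The periodic domain $\Omega$ is tessellated into conforming, non-overlapping elements $\mathcal T_h=\{\Omega_k\}$ with piecewise smooth boundaries, obtained from a reference element by a bijective, time-independent polynomial mapping of degree $p_{\rm geom}\le p+1$ in 2D and $p_{\rm geom}\le\lfloor p/2\rfloor+1$ in 3D. By periodicity every facet is interior, shared by exactly two elements;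 $\Gamma_k^I$ is the set of facets of $\Omega_k$. Element $\Omega_k$ has $n_p$ nodes. For each direction $i$, $\mathsf D_{x_ik}=\mathsf H_k^{-1}\mathsf Q_{x_ik}$ is a degree-$p$ SBP operator: (1) $\mathsf D_{x_ik}$ differentiates polynomials of total degree $\le p$ exactly at the nodes; (2) $\mathsf H_k$ is diagonal with positive entries; (3) $\mathsf Q_{x_ik}=\mathsf S_{x_ik}+\frac12\mathsf E_{x_ik}$ with $\mathsf S_{x_ik}$ skew-symmetric and $\mathsf E_{x_ik}$ diagonal, satisfying $\boldsymbol p^T\mathsf E_{x_ik}\boldsymbol q=\int_{\partial\Omega_k}\mathcal P\mathcal Q\,n_{x_i}\,d\Gamma$ for polynomials $\mathcal P,\mathcal Q$ of degree $\le r$, $r\ge p$; hence $\mathsf Q_{x_ik}+\mathsf Q_{x_ik}^T=\mathsf E_{x_ik}$. Facet nodes are a subset of the volume nodes: for a facet $g$ of $\Omega_k$, $\mathsf R_{gk}$ is the matrix selecting the volume-node values at the $n_f$ facet nodes (facet nodes of adjacent elements coincide and are ordered identically), $\mathsf B_g$ is the diagonal matrix of positive facet quadrature weights, $\mathsf N_{x_ig}$ the diagonal matrix of the $i$-th components of the unit normal on $g$ outward to $\Omega_k$, and $\mathsf E_{x_ik}=\sum_{g}\mathsf E_{x_i}^{kk}$ with $\mathsf E_{x_i}^{kk}=\mathsf R_{gk}^T\mathsf B_g\mathsf N_{x_ig}\mathsf R_{gk}$. If $\Omega_v$ shares $g$ with $\Omega_k$, then $\mathsf E_{x_i}^{kv}=\mathsf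 R_{gk}^T\mathsf B_g\mathsf N_{x_ig}\mathsf R_{gv}$, $\mathsf E_{x_i}^{vk}=-\mathsf R_{gv}^T\mathsf B_g\mathsf N_{x_ig}\mathsf R_{gk}$, $\mathsf E_{x_i}^{vv}=-\mathsf R_{gv}^T\mathsf B_g\mathsf N_{x_ig}\mathsf R_{gv}$ (the outward normal of $\Omega_v$ on $g$ is the negative of that of $\Omega_k$). An overbar denotes $\otimes\,\mathsf I_{n_c}$, $\circ$ is the Hadamard product, $\boldsymbol 1$ the vector of ones. **Nodal quantities.** $\boldsymbol u_k$ stacks the nodal values $\boldsymbol u_{k,m}\in\mathbb R^{n_c}$ of the numerical solution; $\boldsymbol f_k^{I(i)}$ and $\boldsymbol w_k$ stack the values of $\mathcal F^{I(i)}$ and $\mathcal W$ at $\boldsymbol u_{k,m}$; in the discretization $\tilde{\mathsf A}_i$ is the block-diagonal matrix with $n_c\times n_c$ blocks $\tilde{\mathsf A}_i(\boldsymbol u_{k,m})$. **Two-point flux.** $\mathsf F_i(\boldsymbol u_k,\boldsymbol u_v)$ is the block matrix with $(m,n)$ block $2\,\mathrm{diag}[\mathcal F_i^*(\boldsymbol u_{k,m},\boldsymbol u_{v,n})]$, where $\mathcal F_i^*$ is the Sjögreen–Yee two-point flux: with $\boldsymbol z=(\frac\rho p(p\rho^{-\gamma})^{1/(\alpha+\gamma)},V^T,p)^T$, $\{u\}=\frac12(u'+u'')$ and $\{u^{r-1}\}_e=\frac1r\frac{(u')^r-(u'')^r}{u'-u''}$ (extended by continuity), $[\mathcal F_i^*]_1=\frac{\{z_1z_{i+1}\}}{\{z_1^{-\gamma/\alpha}\}\{z_{n_c}^{(1-\gamma-\alpha)/\alpha}\}_e}$,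 $[\mathcal F_i^*]_j=[\mathcal F_i^*]_1\{z_j\}+\delta_{(i+1)j}\{z_{n_c}\}$ for $2\le j\le n_c-1$, $[\mathcal F_i^*]_{n_c}=[\mathcal F_i^*]_1\left(\frac{\gamma}{\gamma-1}\{z_{n_c}^{-(\gamma-1)/\alpha}\}\{z_1^{-(\gamma+\alpha)/\alpha}\}_e+\sum_{j=2}^{n_c-1}\{z_j\}^2-\frac12\{\sum_{j=2}^{n_c-1}z_j^2\}\right)$. It is consistent, $\mathcal F_i^*(\mathcal U,\mathcal U)=\mathcal F^{I(i)}(\mathcal U)$, symmetric, $\mathcal F_i^*(\mathcal U',\mathcal U'')=\mathcal F_i^*(\mathcal U'',\mathcal U')$, and satisfies Tadmor's condition $(\mathcal W''-\mathcal W')^T\mathcal F_i^*(\mathcal U',\mathcal U'')=(\psi^{(i)})''-(\psi^{(i)})'$ with $\psi^{(i)}=\mathcal W^T\mathcal F^{I(i)}-V_i\mathcal S$. *)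

(* Defs.v *)
From mathcomp Require Export all_boot all_order all_algebra.
From mathcomp Require Export all_classical all_reals all_analysis.
From mathcomp Require mpoly.
From mathcomp Require Export mxtens.

Set Implicit Arguments.
Unset Strict Implicit.
Unset Printing Implicit Defensive.

Export Order.TTheory GRing.Theory Num.Theory.
Export numFieldNormedType.Exports.

Local Open Scope classical_set_scope.
Local Open Scope ring_scope.

(** * Euclidean geometry of row vectors
    The library norm on ['rV[R]_d] is the max norm, hence [enorm]. *)

Section Euclidean.
Context {R : realType} {d : nat}.
Implicit Types (x y n : 'rV[R]_d) (A : set 'rV[R]_d).

Definition dotv x y : R := \sum_(i < d) x 0 i * y 0 i.
Definition enorm x : R := Num.sqrt (dotv x x).

Definition translate x A : set 'rV[R]_d := [set y + x | y in A].

(* First order description of the boundary of [A] at [x]: near [x], the set [A]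
   contains every narrower cone around [-n] and avoids every one around [n]. *)
Definition is_outward_unit_normal A x n : Prop :=
  dotv n n = 1 /\
  forall eps : R, 0 < eps ->
    \forall y \near x,
      (eps * enorm (y - x) < dotv (y - x) n -> ~ A y) /\
      (dotv (y - x) n < - (eps * enorm (y - x)) -> A y).

End Euclidean.

(** * Surface integrals
    [hausdorff s] is the [s]-dimensional Hausdorff measure on R^d, normalized to
    agree with [s]-dimensional area on smooth surfaces (for [s = 0] it is the
    counting measure). *)

Section Hausdorff.
Context {R : realType} {d : nat}.
Local Open Scope ereal_scope.
Implicit Types A : set 'rV[R]_d.

(* The union with [0] only matters for [A = set0], whose supremum is -oo. *)
Definition ediam A : \bar R :=
  ereal_sup ([set 0] `|` [set (enorm (x.1 - x.2))%:E | x in A `*` A]).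

(* Volume of the unit ball of R^s. *)
Fixpoint unit_ball_volume (s : nat) : R :=
  match s with
  | 0 => 1
  | 1 => 2
  | s'.+2 => 2 * pi / s%:R * unit_ball_volume s'
  end%R.

Definition hausdorff_weight (s : nat) A : \bar R :=
  if A == set0 then 0 else (unit_ball_volume s / 2 ^+ s)%:E * ediam A ^+ s.

Definition hausdorff_content (s : nat) (delta : R) A : \bar R :=
  ereal_inf [set \sum_(0 <= j <oo) hausdorff_weight s (C j)
            | C in [set C : (set 'rV[R]_d)^nat |
                A `<=` \bigcup_j C j /\ forall j, ediam (C j) <= delta%:E]].

Definition hausdorff (s : nat) A : \bar R :=
  ereal_sup [set hausdorff_content s delta A | delta in [set e : R | (0 < e)%R]].

(* Lebesgue integral, for the Borel sigma-algebra of R^d, with respect to the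
   (d-1)-dimensional Hausdorff measure. *)
Definition surface_integral A (f : 'rV[R]_d -> R) : R :=
  fine (@integral _ (g_sigma_algebraType (@open 'rV[R]_d)) R
          (hausdorff d.-1) A (fun x => (f x)%:E)).

End Hausdorff.

Section Polynomials.
Context {R : realType} {d : nat}.

Definition peval (P : mpoly.mpoly d R) (x : 'rV[R]_d) : R :=
  mpoly.meval (fun i => x 0 i) P.

Definition total_degree_le (deg : nat) (P : mpoly.mpoly d R) : Prop :=
  (\max_(m <- mpoly.msupp P) mpoly.mdeg m <= deg)%N.

End Polynomials.

(** * Curvilinear periodic meshes
    The periodic domain is the torus R^d / Lambda, where Lambda is the lattice
    spanned by the rows of an invertible matrix. An element is represented by
    one of its lifts to R^d. A local facet is a pair (element, facet of the
    reference element), so a facet of the mesh, being shared by two elements,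
    is represented by two local facets. *)

Record mesh (R : realType) (d nfac : nat) (K : finType) := Mesh {
  period : 'M[R]_d;
  ref_elt : set 'rV[R]_d;
  ref_facet : 'I_nfac -> set 'rV[R]_d;
  elt_map : K -> 'I_d -> mpoly.mpoly d R;
  (* the local facet opposite to a given one, and the lattice coordinates of
     the translation taking that opposite facet onto the given one *)
  nbr : K * 'I_nfac -> K * 'I_nfac;
  nbr_shift : K * 'I_nfac -> 'rV[int]_d;
  (* unit normal on a local facet, outward to its element *)
  normal : K * 'I_nfac -> 'rV[R]_d -> 'rV[R]_d
}.

Section Mesh.
Context {R : realType} {d nfac : nat} {K : finType}.
Variable M : mesh R d nfac K.
Implicit Types (k : K) (f : K * 'I_nfac).

Definition lattice (z : 'rV[int]_d) : 'rV[R]_d := map_mx intr z *m period M.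

Definition elt_fun k (xi : 'rV[R]_d) : 'rV[R]_d :=
  \row_i peval (elt_map M k i) xi.
Definition elt k : set 'rV[R]_d := elt_fun k @` ref_elt M.
Definition facet f : set 'rV[R]_d := elt_fun f.1 @` ref_facet M f.2.

Record is_periodic_mesh (pgeom : nat) : Prop := IsPeriodicMesh {
  period_unit : period M \in unitmx;

  ref_compact : compact (ref_elt M);
  ref_regular : closure (interior (ref_elt M)) = ref_elt M;
  ref_interior : interior (ref_elt M) !=set0;
  ref_boundary : ref_elt M `\` interior (ref_elt M) = \bigcup_a ref_facet M a;
  ref_facet_closed : forall a, closed (ref_facet M a);
  ref_facet_proper : forall a,
    ref_facet M a !=set0 /\
    ref_facet M a `<=`
      closure (ref_facet M a `\` \bigcup_(b in [set b | b != a]) ref_facet M b);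

  elt_map_degree : forall k i, total_degree_le pgeom (elt_map M k i);
  elt_map_inj : forall k xi eta, ref_elt M xi -> ref_elt M eta ->
    elt_fun k xi = elt_fun k eta -> xi = eta;

  elt_cover : forall x, exists k z, translate (lattice z) (elt k) x;
  elt_nonoverlap : forall k k' z, (k, z) <> (k', 0) ->
    interior (translate (lattice z) (elt k)) `&` interior (elt k') = set0;

  nbr_involutive : involutive (nbr M);
  nbr_distinct : forall f, (nbr M f).1 != f.1;
  nbr_conforming : forall f,
    facet f = translate (lattice (nbr_shift M f)) (facet (nbr M f));
  nbr_only : forall f f' z, f' != f ->
    facet f = translate (lattice z) (facet f') -> f' = nbr M f;

  (* on the edges of a facet, the normal of the facet is defined by continuity *)
  normal_outward : forall f x, facet f x ->
    (forall b, b != f.2 -> ~ facet (f.1, b) x) ->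
    is_outward_unit_normal (elt f.1) x (normal M f x);
  normal_continuous : forall f, {within facet f, continuous (normal M f)};
  normal_opposite : forall f x, facet f x ->
    normal M (nbr M f) (x - lattice (nbr_shift M f)) = - normal M f x
}.

End Mesh.

Record sbp_data (R : realType) (d nfac np nf : nat) (K : finType) := SbpData {
  node : K -> 'I_np -> 'rV[R]_d;
  facet_node : K * 'I_nfac -> 'I_nf -> 'I_np;
  facet_weight : K * 'I_nfac -> 'rV[R]_nf;
  Hmx : K -> 'M[R]_np;
  Smx : K -> 'I_d -> 'M[R]_np
}.

Section SBP.
Context {R : realType} {d nfac np nf : nat} {K : finType}.
Variables (M : mesh R d nfac K) (ops : sbp_data R d nfac np nf K).
Implicit Types (k : K) (f : K * 'I_nfac) (i : 'I_d).

Definition Rmx f : 'M[R]_(nf, np) := \matrix_(j, m) (m == facet_node ops f j)%:R.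
Definition Bmx f : 'M[R]_nf := diag_mx (facet_weight ops f).
Definition Nmx f i : 'M[R]_nf :=
  diag_mx (\row_j normal M f (node ops f.1 (facet_node ops f j)) 0 i).

(* [E^{kk}] and [E^{kv}] for the local facet [f] of element [k = f.1], with
   [v = (nbr M f).1]. *)
Definition Ekk f i : 'M[R]_np := (Rmx f)^T *m Bmx f *m Nmx f i *m Rmx f.
Definition Ekv f i : 'M[R]_np :=
  (Rmx f)^T *m Bmx f *m Nmx f i *m Rmx (nbr M f).

Definition Emx k i : 'M[R]_np := \sum_(a < nfac) Ekk (k, a) i.
Definition Qmx k i : 'M[R]_np := Smx ops k i + 2^-1 *: Emx k i.
Definition Dmx k i : 'M[R]_np := invmx (Hmx ops k) *m Qmx k i.

Definition nodal k (g : 'rV[R]_d -> R) : 'cV[R]_np := \col_m g (node ops k m).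

Record is_sbp (p r : nat) : Prop := IsSbp {
  degree_le : (p <= r)%N;

  node_in : forall k m, elt M k (node ops k m);
  node_inj : forall k, injective (node ops k);
  facet_node_in : forall f j, facet M f (node ops f.1 (facet_node ops f j));
  facet_node_inj : forall f, injective (facet_node ops f);
  facet_node_match : forall f j,
    node ops f.1 (facet_node ops f j) =
    node ops (nbr M f).1 (facet_node ops (nbr M f) j) + lattice M (nbr_shift M f);
  facet_weight_pos : forall f j, 0 < facet_weight ops f 0 j;
  facet_weight_nbr : forall f, facet_weight ops (nbr M f) = facet_weight ops f;

  Hmx_diag : forall k, is_diag_mx (Hmx ops k);
  Hmx_pos : forall k m, 0 < Hmx ops k m m;
  Smx_skew : forall k i, (Smx ops k i)^T = - Smx ops k i;

  Dmx_exact : forall k i P, total_degree_le p P ->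
    Dmx k i *m nodal k (peval P) = nodal k (peval (mpoly.mderiv i P));
  Emx_exact : forall k i P Q, total_degree_le r P -> total_degree_le r Q ->
    ((nodal k (peval P))^T *m Emx k i *m nodal k (peval Q)) 0 0 =
    \sum_(a < nfac) surface_integral (facet M (k, a))
      (fun x => peval P x * peval Q x * normal M (k, a) x 0 i)
}.

End SBP.

(* A state is the row vector (density, momentum, total energy) of size
    [1 + (d + 1)], that is [d + 2]. *)

Notation nvar d := (1 + (d + 1))%N.

Section Euler.
Context {R : realType} {d : nat}.
Implicit Types (u : 'rV[R]_(nvar d)) (i : 'I_d) (alpha : R).

Definition gamma : R := 7 / 5.
Definition beta alpha : R := - (gamma + alpha) / (gamma - 1).

Definition mk_state (a : R) (b : 'rV[R]_d) (c : R) : 'rV[R]_(nvar d) :=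
  row_mx a%:M (row_mx b c%:M).

Definition density u : R := lsubmx u 0 0.
Definition velocity u : 'rV[R]_d := (density u)^-1 *: lsubmx (rsubmx u).
Definition energy u : R := rsubmx (rsubmx u) 0 0.
Definition pressure u : R :=
  (gamma - 1) * (energy u - 2^-1 * density u * dotv (velocity u) (velocity u)).

Definition admissible : set 'rV[R]_(nvar d) :=
  [set u | 0 < density u /\ 0 < pressure u].

Definition euler_flux i u : 'rV[R]_(nvar d) :=
  let V := velocity u in
  mk_state (density u * V 0 i)
           (\row_j (density u * V 0 i * V 0 j + (i == j)%:R * pressure u))
           ((energy u + pressure u) * V 0 i).

Definition entropy alpha u : R :=
  beta alpha * density u *
  (pressure u * density u `^ (- gamma)) `^ (1 / (alpha + gamma)).

Definition entropy_var alpha u : 'rV[R]_(nvar d) :=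
  \row_c 'D_(delta_mx 0 c) (entropy alpha) u.

(* The inverse of [entropy_var alpha] on the image of the admissible states. *)
Definition state_of_entropy_var alpha : 'rV[R]_(nvar d) -> 'rV[R]_(nvar d) :=
  pinv_ (fun=> 0) admissible (entropy_var alpha).

(* The Jacobian of the flux with respect to the entropy variables, with the
   derivatives of its [b]-th component on the [b]-th row. *)
Definition Atilde alpha i u : 'M[R]_(nvar d) :=
  \matrix_(b, c) 'D_(delta_mx 0 c)
    (fun w => euler_flux i (state_of_entropy_var alpha w) 0 b)
    (entropy_var alpha u).

Definition mean (a b : R) : R := (a + b) / 2.

(* {u^(r-1)}_e with [s = r - 1]: the integral mean of the power function of
   exponent [s] between [a] and [b], which gives the value at [a = b]. *)
Definition exp_mean (s a b : R) : R :=
  if a == b then a `^ s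
  else (a `^ (s + 1) - b `^ (s + 1)) / ((s + 1) * (a - b)).

Definition zvar1 alpha u : R :=
  density u / pressure u *
  (pressure u * density u `^ (- gamma)) `^ (1 / (alpha + gamma)).

(* The Sjögreen-Yee two-point flux. *)
Definition sy_flux alpha i (u1 u2 : 'rV[R]_(nvar d)) : 'rV[R]_(nvar d) :=
  let z1 := zvar1 alpha u1 in let z2 := zvar1 alpha u2 in
  let V1 := velocity u1 in let V2 := velocity u2 in
  let p1 := pressure u1 in let p2 := pressure u2 in
  let f1 := mean (z1 * V1 0 i) (z2 * V2 0 i) /
    (mean (z1 `^ (- gamma / alpha)) (z2 `^ (- gamma / alpha)) *
     exp_mean ((1 - gamma - alpha) / alpha) p1 p2) in
  mk_state f1
    (\row_j (f1 * mean (V1 0 j) (V2 0 j) + (i == j)%:R * mean p1 p2))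
    (f1 *
      (gamma / (gamma - 1) *
         mean (p1 `^ (- (gamma - 1) / alpha)) (p2 `^ (- (gamma - 1) / alpha)) *
         exp_mean (- (gamma + alpha) / alpha) z1 z2
       + \sum_(j < d) mean (V1 0 j) (V2 0 j) ^+ 2
       - 2^-1 * mean (\sum_(j < d) V1 0 j ^+ 2) (\sum_(j < d) V2 0 j ^+ 2))).

End Euler.

(** * Global vectors and matrices on an element
    The index set ['I_(np * nvar d)] is identified with pairs (node, component)
    by [mxtens_index], the ordering used by the Kronecker product [*t]. *)

Section Nodal.
Context {R : realType} {d np : nat}.
Implicit Types U : 'I_np -> 'rV[R]_(nvar d).

Definition stack U : 'cV[R]_(np * nvar d) :=
  \col_q U (mxtens_unindex q).1 0 (mxtens_unindex q).2.

Definition kron (A : 'M[R]_np) : 'M[R]_(np * nvar d) :=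
  A *t (1%:M : 'M[R]_(nvar d)).

Definition block_mx_of (B : 'I_np -> 'I_np -> 'M[R]_(nvar d)) :
    'M[R]_(np * nvar d) :=
  \matrix_(q, s) B (mxtens_unindex q).1 (mxtens_unindex s).1
                   (mxtens_unindex q).2 (mxtens_unindex s).2.

Definition Atilde_mx (alpha : R) (i : 'I_d) U : 'M[R]_(np * nvar d) :=
  block_mx_of (fun m n => if m == n then Atilde alpha i (U m) else 0).

Definition Fmx (alpha : R) (i : 'I_d) U U' : 'M[R]_(np * nvar d) :=
  block_mx_of (fun m n => 2 *: diag_mx (sy_flux alpha i (U m) (U' n))).

Definition hadamard (m n : nat) (A B : 'M[R]_(m, n)) : 'M[R]_(m, n) :=
  map2_mx *%R A B.

End Nodal.

(* Main.v *)
Require Import Defs.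
From mathcomp Require Import ring lra.

(** Pair the scheme on an element with the entropy variables [W], weighted by
    the quadrature matrix [H]. By the chain rule the time derivative gives the
    entropy rate of the element ([is_derive_entropy], [entropy_varE]), so the
    claim is that the pairings of all other terms cancel over the mesh.

    The first ingredient is Harten's homogeneity. With
    [psi_i = z1 * V_i * p] the flux [F_i] is the gradient of [psi_i] with
    respect to [W] ([is_derive_potential_of_var]), and
    [W . F_i = (beta + 1) psi_i] ([dot_flux_of_var]). Differentiating the
    second identity and inserting the first gives [W^T A_i = beta F_i^T]
    ([Atilde_homogeneous]). The usual argument reads this from the symmetry
    of [A_i] and Euler's relation [A_i W = beta F_i]; differentiating
    [W . F_i] along lines avoids the second derivatives behind the symmetry.

    Because of this identity the two volume terms, paired with [W], are
    [beta / (beta + 1)] times [w^T Q f] and [f^T Q w], and their sum collapses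
    to the boundary by [Q + Q^T = E]. The first term of the right-hand side
    is [w^T E f], so [(beta + 1)^-1 w^T E f] is left, which is [psi]
    summed against the facet weights. An element thus gains on each facet node
    the weighted quantity [psi (u) - W (u) . F* (u, v)], where [v] is the state
    on the other side ([element_balance]).

    Across a facet the normal changes sign while the two-point flux is
    symmetric, so the two sides add up to
    [psi (u) - psi (v) - (W (u) - W (v)) . F* (u, v)], which is zero by
    Tadmor's condition ([tadmor], [facet_production_nbr]). As the neighbour map
    is an involution of the local facets, the total vanishes. *)

Set Implicit Arguments.
Unset Strict Implicit.
Unset Printing Implicit Defensive.

Local Open Scope classical_set_scope.
Local Open Scope ring_scope.

(** * Dot products and components of states *)

Section DotProduct.
Context {R : realType} {n : nat}.
Implicit Types x y z : 'rV[R]_n.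

Lemma dotvC x y : dotv x y = dotv y x.
Proof. by apply: eq_bigr => i _; rewrite mulrC. Qed.

Lemma dotvDl x y z : dotv (x + y) z = dotv x z + dotv y z.
Proof. by rewrite -big_split; apply: eq_bigr => i _; rewrite mxE mulrDl. Qed.

Lemma dotvZl a x y : dotv (a *: x) y = a * dotv x y.
Proof. by rewrite mulr_sumr; apply: eq_bigr => i _; rewrite mxE mulrA. Qed.

Lemma dotvNl x y : dotv (- x) y = - dotv x y.
Proof. by rewrite -scaleN1r dotvZl mulN1r. Qed.

Lemma dotvDr x y z : dotv x (y + z) = dotv x y + dotv x z.
Proof. by rewrite dotvC dotvDl !(dotvC x). Qed.

Lemma dotvZr a x y : dotv x (a *: y) = a * dotv x y.
Proof. by rewrite dotvC dotvZl dotvC. Qed.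

Lemma dotv_suml (I : finType) (x : I -> 'rV[R]_n) y :
  dotv (\sum_i x i) y = \sum_i dotv (x i) y.
Proof.
rewrite /dotv exchange_big; apply: eq_bigr => j _.
by rewrite summxE mulr_suml.
Qed.

Lemma dotv_delta x i : dotv x (delta_mx 0 i) = x 0 i.
Proof.
rewrite /dotv (bigD1 i)//= mxE !eqxx mulr1 big1 ?addr0// => j ji.
by rewrite mxE (negbTE ji) andbF mulr0.
Qed.

End DotProduct.

Section States.
Context {R : realType} {d : nat}.
Implicit Types (u w : 'rV[R]_(nvar d)) (a c : R) (b : 'rV[R]_d) (i : 'I_d).

(** [density], [momentum] and [energy] also serve as the component projections
    of fluxes and of entropy variables, which have the same shape as states. *)
Definition momentum u : 'rV[R]_d := lsubmx (rsubmx u).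

Lemma density_mk a b c : density (mk_state a b c) = a.
Proof. by rewrite /density row_mxKl !mxE eqxx mulr1n. Qed.

Lemma momentum_mk a b c : momentum (mk_state a b c) = b.
Proof. by rewrite /momentum row_mxKr row_mxKl. Qed.

Lemma energy_mk a b c : energy (mk_state a b c) = c.
Proof. by rewrite /energy row_mxKr row_mxKr !mxE eqxx mulr1n. Qed.

Lemma velocity_mk a b c : velocity (mk_state a b c) = a^-1 *: b.
Proof. by rewrite /velocity density_mk -/(momentum _) momentum_mk. Qed.

Definition mk_stateK := (density_mk, momentum_mk, energy_mk, velocity_mk).

Lemma mk_state_eta u : mk_state (density u) (momentum u) (energy u) = u.
Proof.
by rewrite /mk_state /density /momentum /energy -!mx11_scalar !hsubmxK.
Qed.

Lemma dotv_state u w : dotv u w =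
  density u * density w + dotv (momentum u) (momentum w) + energy u * energy w.
Proof.
rewrite {1}/dotv big_split_ord big_ord1 big_split_ord big_ord1/= addrA.
rewrite /density /energy !mxE /dotv; congr (_ + _ + _).
by apply: eq_bigr => j _; rewrite !mxE.
Qed.

Lemma velocityE u i : velocity u 0 i = momentum u 0 i / density u.
Proof. by rewrite mxE mulrC. Qed.

End States.

(** * Differentiation along curves *)

Section Curves.
Context {R : realType}.
Implicit Types (f g : R -> R) (t df dg a : R).

Lemma is_derive_mul f g t df dg : is_derive t 1 f df -> is_derive t 1 g dg ->
  is_derive t 1 (fun s => f s * g s) (df * g t + f t * dg).
Proof.
move=> hf hg; apply: (@is_derive_eq _ _ _ _ _ _ _ _ (is_deriveM hf hg)).
by rewrite addrC [df * _]mulrC.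
Qed.

Lemma is_derive_add f g t df dg : is_derive t 1 f df -> is_derive t 1 g dg ->
  is_derive t 1 (fun s => f s + g s) (df + dg).
Proof. by move=> hf hg; exact: is_deriveD. Qed.

Lemma is_derive_const a t : is_derive t 1 (fun=> a) 0.
Proof. exact: is_derive_cst. Qed.

Lemma is_derive_inv f t df : is_derive t 1 f df -> f t != 0 ->
  is_derive t 1 (fun s => (f s)^-1) (- (df / (f t) ^+ 2)).
Proof.
move=> hf ft; apply: (@is_derive_eq _ _ _ _ _ _ _ _ (is_deriveV ft hf)).
by rewrite scaleNr mulrC.
Qed.

Lemma is_derive_dotv n (x y : R -> 'rV[R]_n) t (dx dy : 'rV[R]_n) :
  (forall i, is_derive t 1 (fun s => x s 0 i) (dx 0 i)) ->
  (forall i, is_derive t 1 (fun s => y s 0 i) (dy 0 i)) ->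
  is_derive t 1 (fun s => dotv (x s) (y s)) (dotv dx (y t) + dotv (x t) dy).
Proof.
move=> hx hy; rewrite /dotv -big_split/=.
have h i := is_derive_mul (hx i) (hy i).
have := is_derive_sum h.
by rewrite (_ : \sum_i _ = fun s => \sum_(i < n) x s 0 i * y s 0 i)//;
  apply/funext => s; rewrite fct_sumE.
Qed.

Lemma is_derive_powR f t df a : is_derive t 1 f df -> 0 < f t ->
  is_derive t 1 (fun s => f s `^ a) (a * f t `^ a * (df / f t)).
Proof.
move=> hf ft.
have h := @is_derive1_comp R (fun x : R => x `^ a) f t _ _
            (is_derive1_powR a ft) hf.
apply: (@is_derive_eq _ _ _ _ _ _ _ _ h).
rewrite powRB; last by rewrite (gt_eqF ft) implybT.
by rewrite powRr1 ?ltW//; ring.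
Qed.

(** Strict inequalities persist near a point of differentiability, which lets
    the thermodynamic formulas be used on a neighbourhood. *)
Lemma is_derive_gt0 f t df : is_derive t 1 f df -> 0 < f t ->
  \forall s \near t, 0 < f s.
Proof.
move=> [/derivable1_diffP/differentiable_continuous hf _] ft.
by move/cvgrPdist_lt: hf => /(_ _ ft); apply: filterS => s;
  rewrite ltr_distlC subrr => /andP[].
Qed.

Lemma is_derive_coord n (x : R -> 'rV[R]_n) t i : derivable x t 1 ->
  is_derive t 1 (fun s => x s 0 i) ('D_1 x t 0 i).
Proof.
move=> hx; split; last by rewrite derive_mx// mxE.
by move/derivable_mxP: hx; exact.
Qed.

Lemma is_derive_line n (u v : 'rV[R]_n) t :
  is_derive t 1 (fun s => s *: v + u) v.
Proof.
have h k : is_derive t 1 (fun s => (s *: v + u) 0 k) (v 0 k).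
  have h := is_derive_add
    (is_derive_mul (is_derive_id t 1) (is_derive_const (v 0 k) t))
    (is_derive_const (u 0 k) t).
  rewrite (_ : (fun s => _) = fun s => s * v 0 k + u 0 k).
    by apply: (@is_derive_eq _ _ _ _ _ _ _ _ h); rewrite mulr0 !addr0 mul1r.
  by apply/funext => s; rewrite !mxE.
have dh : derivable (fun s : R => s *: v + u) t 1.
  by apply/derivable_mxP => i k; rewrite ord1.
by split=> //; apply/rowP => k; rewrite derive_mx// mxE derive_val.
Qed.

(** Reduces the partial derivatives in the entropy variables and in the flux
    Jacobian to derivatives along curves. *)
Lemma derive_along_line (V W : normedModType R) (f : V -> W) (u v : V) :
  'D_v f u = 'D_1 (fun s : R => f (s *: v + u)) 0.
Proof.
rewrite /derive; set g1 := fun h => h^-1 *: _; set g2 := fun h => h^-1 *: _.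
suff -> : g1 = g2 by [].
apply/funext => s; rewrite /g1 /g2 /=.
by rewrite addr0 scale0r add0r [_%:A]mulr1.
Qed.

End Curves.

(** * The chain rule for the entropy *)

Section EntropyExponents.
Context {R : realType}.
Variable alpha : R.
Hypothesis alpha_range : 0 < alpha \/ alpha < - gamma.

Lemma alpha_neq0 : alpha != 0.
Proof.
case: alpha_range => h; first by rewrite gt_eqF.
by rewrite lt_eqF//; move: h; rewrite /gamma; lra.
Qed.

Lemma alphaDgamma_neq0 : alpha + gamma != 0.
Proof.
by case: alpha_range => h; [rewrite gt_eqF//|rewrite lt_eqF//];
  move: h; rewrite /gamma; lra.
Qed.

Lemma betaD1_neq0 : beta alpha + 1 != 0.
Proof.
have -> : beta alpha + 1 = - (alpha + 1) / (gamma - 1).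
  by rewrite /beta /gamma; field.
rewrite mulf_neq0 ?invr_eq0 ?oppr_eq0//; last by rewrite /gamma; apply/eqP; lra.
by case: alpha_range => h; [rewrite gt_eqF//|rewrite lt_eqF//];
  move: h; rewrite /gamma; lra.
Qed.

Lemma gammaB1_gt0 : 0 < gamma - 1 :> R.
Proof. by rewrite /gamma; lra. Qed.

End EntropyExponents.

Section EntropyVariables.
Context {R : realType} {d : nat}.
Implicit Types (alpha t : R) (u w : 'rV[R]_(nvar d)) (i : 'I_d).

(** Holds also at zero density, because of [0^-1 = 0]; the pressure can then be
    differentiated as a rational function of the conserved variables. *)
Lemma dotv_velocity u :
  density u * dotv (velocity u) (velocity u) =
  dotv (momentum u) (momentum u) / density u.
Proof.
rewrite /velocity -/(momentum u) dotvZl dotvZr.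
have [->|h] := eqVneq (density u) 0; first by rewrite invr0 !mul0r mulr0.
by field.
Qed.

Definition temperature u : R := pressure u / density u.

(** Harten's closed form; it is the gradient of the entropy by
    [entropy_varE]. *)
Definition explicit_entropy_var alpha u : 'rV[R]_(nvar d) :=
  mk_state
    (zvar1 alpha u * (- (alpha / (gamma - 1)) * temperature u
                      - 2^-1 * dotv (velocity u) (velocity u)))
    (zvar1 alpha u *: velocity u) (- zvar1 alpha u).

Lemma is_derive_density (c : R -> 'rV[R]_(nvar d)) t : derivable c t 1 ->
  is_derive t 1 (fun s => density (c s)) (density ('D_1 c t)).
Proof.
move=> hc; rewrite /density mxE.
rewrite (_ : (fun s => _) = fun s => c s 0 (lshift (d + 1) 0));
  first exact: is_derive_coord.
by apply/funext => s; rewrite mxE.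
Qed.

Lemma is_derive_momentum (c : R -> 'rV[R]_(nvar d)) t i : derivable c t 1 ->
  is_derive t 1 (fun s => momentum (c s) 0 i) (momentum ('D_1 c t) 0 i).
Proof.
move=> hc; rewrite !mxE.
rewrite (_ : (fun s => _) = fun s => c s 0 (rshift 1 (lshift 1 i)));
  first exact: is_derive_coord.
by apply/funext => s; rewrite !mxE.
Qed.

Lemma is_derive_energy (c : R -> 'rV[R]_(nvar d)) t : derivable c t 1 ->
  is_derive t 1 (fun s => energy (c s)) (energy ('D_1 c t)).
Proof.
move=> hc; rewrite /energy !mxE.
rewrite (_ : (fun s => _) = fun s => c s 0 (rshift 1 (rshift d 0)));
  first exact: is_derive_coord.
by apply/funext => s; rewrite !mxE.
Qed.

Lemma is_derive_pressure (c : R -> 'rV[R]_(nvar d)) t (dc := 'D_1 c t)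
    (V := velocity (c t)) :
  density (c t) != 0 -> derivable c t 1 ->
  is_derive t 1 (fun s => pressure (c s))
    ((gamma - 1) *
     (energy dc - dotv V (momentum dc) + 2^-1 * dotv V V * density dc)).
Proof.
move=> r0 hc.
have hr := is_derive_density hc; have he := is_derive_energy hc.
have hm i := is_derive_momentum i hc.
have hmm := is_derive_dotv hm hm.
have h := is_derive_mul (is_derive_const (gamma - 1) t)
  (is_derive_add he (is_derive_mul (is_derive_const (- 2^-1) t)
     (is_derive_mul hmm (is_derive_inv hr r0)))).
rewrite /pressure.
under eq_fun do rewrite -mulrA dotv_velocity -mulNr.
apply: (@is_derive_eq _ _ _ _ _ _ _ _ h).
rewrite /V /velocity -/(momentum _) -/dc !(dotvZl, dotvZr).
rewrite (dotvC (momentum dc)).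
by field.
Qed.

(** Stated for arbitrary curves since it is needed twice: along coordinate
    lines it gives the entropy variables, and along the discrete solution it
    gives the entropy rate. *)
Lemma is_derive_entropy alpha (c : R -> 'rV[R]_(nvar d)) t :
  alpha + gamma != 0 ->
  admissible (c t) -> derivable c t 1 ->
  is_derive t 1 (fun s => entropy alpha (c s))
    (dotv (explicit_entropy_var alpha (c t)) ('D_1 c t)).
Proof.
move=> ag0 [r_gt0 p_gt0] hc.
have r0 : density (c t) != 0 by rewrite gt_eqF.
have p0 : pressure (c t) != 0 by rewrite gt_eqF.
have hr := is_derive_density hc; have hp := is_derive_pressure r0 hc.
have s_gt0 : 0 < pressure (c t) * density (c t) `^ (- gamma).
  by rewrite mulr_gt0 ?powR_gt0.
have h := is_derive_mul (is_derive_mul (is_derive_const (beta alpha) t) hr)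
  (is_derive_powR (1 / (alpha + gamma))
     (is_derive_mul hp (is_derive_powR (- gamma) hr r_gt0)) s_gt0).
rewrite /entropy; apply: (@is_derive_eq _ _ _ _ _ _ _ _ h).
rewrite dotv_state !mk_stateK dotvZl /zvar1 /temperature /beta.
have rg0 : density (c t) `^ (- gamma) != 0 by rewrite gt_eqF ?powR_gt0.
set S := (_ * _) `^ _; set G := _ `^ (- gamma).
have g0 : gamma - 1 != 0 :> R by rewrite gt_eqF ?gammaB1_gt0.
field.
by rewrite rg0 ag0 r0 p0 g0.
Qed.

Lemma entropy_varE alpha u : alpha + gamma != 0 -> admissible u ->
  entropy_var alpha u = explicit_entropy_var alpha u.
Proof.
move=> ag0 hu; apply/rowP => k; rewrite mxE.
pose c (s : R) : 'rV[R]_(nvar d) := s *: delta_mx 0 k + u.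
have hc : is_derive (0 : R) 1 c (delta_mx 0 k : 'rV[R]_(nvar d)).
  exact: is_derive_line.
have c0 : c 0 = u by rewrite /c scale0r add0r.
have h : is_derive (0 : R) 1 (fun s => entropy alpha (c s))
    (dotv (explicit_entropy_var alpha (c 0)) ('D_1 c 0)).
  by apply: is_derive_entropy; rewrite // c0.
rewrite derive_along_line.
rewrite (@derive_val _ _ _ _ _ _ _ h).
rewrite c0 (@derive_val _ _ _ _ _ _ _ hc).
by rewrite dotv_delta.
Qed.

End EntropyVariables.

(** * Inverting the entropy variables *)

Section Inverse.
Context {R : realType} {d : nat}.
Variable alpha : R.
Hypothesis alpha_range : 0 < alpha \/ alpha < - gamma.
Implicit Types (t : R) (u w : 'rV[R]_(nvar d)) (i : 'I_d).

Let alpha0 : alpha != 0. Proof. exact: alpha_neq0. Qed.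
Let ag0 : alpha + gamma != 0. Proof. exact: alphaDgamma_neq0. Qed.
Let g10 : gamma - 1 != 0 :> R. Proof. by rewrite gt_eqF ?gammaB1_gt0. Qed.

(** If [w = z1 * (- alpha / (gamma - 1) * T - V^2 / 2, V, -1)] then
    [energy w = - z1] and [momentum w = z1 *: V], so the first component gives
    the temperature [T]. *)
Definition temperature_of_var w : R :=
  (gamma - 1) / alpha *
  (density w / energy w
   - 2^-1 * dotv (momentum w) (momentum w) / energy w ^+ 2).

(** From [z1 = T^-1 * (p rho^-gamma)^(1 / (alpha + gamma))] and [p = rho * T]:
    [(z1 T)^(alpha + gamma) = T * rho^(1 - gamma)], solved for [rho]. *)
Definition density_of_var w : R :=
  temperature_of_var w `^ ((1 - alpha - gamma) / (gamma - 1)) *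
  (- energy w) `^ (- (alpha + gamma) / (gamma - 1)).

Definition pressure_of_var w : R :=
  temperature_of_var w `^ (- alpha / (gamma - 1)) *
  (- energy w) `^ (- (alpha + gamma) / (gamma - 1)).

Definition velocity_of_var w : 'rV[R]_d := (- energy w)^-1 *: momentum w.

Definition state_of_var w : 'rV[R]_(nvar d) :=
  mk_state (density_of_var w) (density_of_var w *: velocity_of_var w)
    (pressure_of_var w / (gamma - 1)
     + 2^-1 * density_of_var w * dotv (velocity_of_var w) (velocity_of_var w)).

(** The image of the admissible states. It is open, hence the derivatives in
    [Atilde] only see the explicit inverse [state_of_var]. *)
Definition var_region w : Prop := energy w < 0 /\ 0 < temperature_of_var w.

Lemma pressure_of_varE w : 0 < temperature_of_var w ->
  pressure_of_var w = density_of_var w * temperature_of_var w.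
Proof.
move=> th0; rewrite /pressure_of_var /density_of_var mulrAC; congr (_ * _).
rewrite -[X in _ = _ * X]powRr1 ?ltW//.
rewrite -powRD; last by rewrite (gt_eqF th0) implybT.
by congr (_ `^ _); field.
Qed.

Lemma density_of_var_gt0 w : var_region w -> 0 < density_of_var w.
Proof. by move=> [q0 th0]; rewrite mulr_gt0 ?powR_gt0 ?oppr_gt0. Qed.

Lemma density_state_of_var w : density (state_of_var w) = density_of_var w.
Proof. by rewrite mk_stateK. Qed.

Lemma velocity_state_of_var w : var_region w ->
  velocity (state_of_var w) = velocity_of_var w.
Proof.
move=> /density_of_var_gt0 r0.
by rewrite mk_stateK scalerA mulVf ?scale1r ?gt_eqF.
Qed.

Lemma pressure_state_of_var w : var_region w ->
  pressure (state_of_var w) = pressure_of_var w.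
Proof.
move=> hw; rewrite /pressure velocity_state_of_var// !mk_stateK; field.
exact: g10.
Qed.

Lemma admissible_state_of_var w : var_region w -> admissible (state_of_var w).
Proof.
move=> hw; split; first by rewrite density_state_of_var density_of_var_gt0.
rewrite pressure_state_of_var// pressure_of_varE; last by case: hw.
by rewrite mulr_gt0 ?density_of_var_gt0//; case: hw.
Qed.

Lemma zvar1_gt0 u : admissible u -> 0 < zvar1 alpha u.
Proof.
by move=> [r0 p0]; rewrite mulr_gt0 ?divr_gt0 ?powR_gt0// mulr_gt0 ?powR_gt0.
Qed.

Lemma temperature_gt0 u : admissible u -> 0 < temperature u.
Proof. by move=> [r0 p0]; exact: divr_gt0. Qed.

Lemma ln_temperature u : admissible u ->
  ln (temperature u) = ln (pressure u) - ln (density u).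
Proof. by move=> [r0 p0]; rewrite ln_div. Qed.

(** Identities between products of real powers are checked below by taking
    logarithms, which turns them into identities of rational functions. *)
Lemma ln_zvar1 u : admissible u ->
  ln (zvar1 alpha u) = ln (density u) - ln (pressure u)
    + 1 / (alpha + gamma) * (ln (pressure u) - gamma * ln (density u)).
Proof.
rewrite /zvar1 => -[]; move: (density u) (pressure u) => r p r0 p0.
have rg0 : 0 < r `^ (- gamma) by exact: powR_gt0.
have s0 : 0 < p * r `^ (- gamma) by exact: mulr_gt0.
rewrite lnM ?posrE ?divr_gt0 ?powR_gt0// ln_div// ln_powR lnM ?posrE// ln_powR.
by rewrite mulNr.
Qed.

Lemma zvar1_state_of_var w : var_region w ->
  zvar1 alpha (state_of_var w) = - energy w.
Proof.
move=> hw; have [q0 th0] := hw; have hu := admissible_state_of_var hw.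
have nq0 : 0 < - energy w by rewrite oppr_gt0.
have zq0 := zvar1_gt0 hu.
apply: ln_inj; rewrite ?posrE//.
rewrite (ln_zvar1 hu) pressure_state_of_var// density_state_of_var.
have -> : ln (density_of_var w) =
    (1 - alpha - gamma) / (gamma - 1) * ln (temperature_of_var w)
    - (alpha + gamma) / (gamma - 1) * ln (- energy w).
  by rewrite lnM ?posrE ?powR_gt0// !ln_powR !mulNr.
have -> : ln (pressure_of_var w) =
    - (alpha / (gamma - 1)) * ln (temperature_of_var w)
    - (alpha + gamma) / (gamma - 1) * ln (- energy w).
  by rewrite lnM ?posrE ?powR_gt0// !ln_powR !mulNr.
by field; rewrite ag0 g10.
Qed.

Lemma explicit_entropy_var_state_of_var w : var_region w ->
  explicit_entropy_var alpha (state_of_var w) = w.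
Proof.
move=> hw; have [q0 th0] := hw; have q00 : energy w != 0 by rewrite lt_eqF.
rewrite -[RHS]mk_state_eta /explicit_entropy_var zvar1_state_of_var// opprK.
rewrite velocity_state_of_var// {2}/velocity_of_var scalerA mulfV ?oppr_eq0//.
rewrite scale1r; congr mk_state.
rewrite /temperature pressure_state_of_var// density_state_of_var.
rewrite pressure_of_varE// [density_of_var _ * _]mulrC mulfK; last first.
  by rewrite gt_eqF ?density_of_var_gt0.
rewrite /velocity_of_var dotvZl dotvZr /temperature_of_var.
by field; rewrite alpha0 g10 q00.
Qed.

Lemma temperature_of_explicit u : admissible u ->
  temperature_of_var (explicit_entropy_var alpha u) = temperature u.
Proof.
move=> hu; have q0 : zvar1 alpha u != 0 by rewrite gt_eqF ?zvar1_gt0.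
rewrite /temperature_of_var !mk_stateK dotvZl dotvZr.
by field; rewrite alpha0 g10 q0.
Qed.

Lemma var_region_explicit u : admissible u ->
  var_region (explicit_entropy_var alpha u).
Proof.
move=> hu; split; first by rewrite !mk_stateK oppr_lt0 zvar1_gt0.
by rewrite temperature_of_explicit// temperature_gt0.
Qed.

(** Injectivity of the entropy variables on admissible states. *)
Lemma explicit_entropy_varK u : admissible u ->
  state_of_var (explicit_entropy_var alpha u) = u.
Proof.
move=> hu; have [r0 p0] := hu; have q0 := zvar1_gt0 hu.
set w := explicit_entropy_var alpha u.
have th0 := temperature_gt0 hu.
have er : density_of_var w = density u.
  rewrite /density_of_var temperature_of_explicit// !mk_stateK opprK.
  have lT := ln_temperature hu; have lq := ln_zvar1 hu.
  have T0 := temperature_gt0 hu.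
  move: (density u) (temperature u) (zvar1 alpha u) r0 T0 q0 lT lq
    => r T q r0 T0 q0 lT lq.
  apply: ln_inj; [by rewrite posrE mulr_gt0 ?powR_gt0|by rewrite posrE|].
  rewrite lnM ?posrE ?powR_gt0// ln_powR ln_powR lT lq.
  by field; rewrite ag0 g10.
have eV : velocity_of_var w = velocity u.
  by rewrite /velocity_of_var !mk_stateK opprK scalerA mulVf ?scale1r ?gt_eqF.
have ep : pressure_of_var w = pressure u.
  rewrite pressure_of_varE temperature_of_explicit// er.
  by rewrite /temperature mulrC divfK ?gt_eqF.
rewrite /state_of_var er eV ep -[RHS]mk_state_eta; congr mk_state.
  by rewrite /velocity scalerA mulfV ?scale1r ?gt_eqF.
by rewrite /pressure; field; exact: g10.
Qed.

Lemma state_of_entropy_varE w : var_region w ->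
  state_of_entropy_var alpha w = state_of_var w.
Proof.
move=> hw; have ha := admissible_state_of_var hw.
rewrite -{1}(explicit_entropy_var_state_of_var hw) -entropy_varE//.
apply: pinvKV; last exact: mem_set.
move=> u v /set_mem hu /set_mem hv.
rewrite (entropy_varE ag0 hu) (entropy_varE ag0 hv) => e.
by rewrite -(explicit_entropy_varK hu) e explicit_entropy_varK.
Qed.

End Inverse.

(** * Homogeneity of the flux in the entropy variables *)

Section FluxCurves.
Context {R : realType} {d : nat}.
Implicit Types (t : R) (i : 'I_d).

(** The entropy flux potential [W . F_i - V_i * S]. *)
Definition potential alpha i (u : 'rV[R]_(nvar d)) : R :=
  zvar1 alpha u * velocity u 0 i * pressure u.

Lemma dotv_euler_flux i (u x : 'rV[R]_(nvar d)) : dotv (euler_flux i u) x =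
  density u * velocity u 0 i * (density x + dotv (velocity u) (momentum x))
  + pressure u * momentum x 0 i
  + (energy u + pressure u) * velocity u 0 i * energy x.
Proof.
rewrite dotv_state !mk_stateK.
rewrite (_ : \row_j _ = (density u * velocity u 0 i) *: velocity u
                        + pressure u *: delta_mx 0 i).
  by rewrite dotvDl !dotvZl [dotv (delta_mx _ _) _]dotvC dotv_delta; ring.
by apply/rowP => j; rewrite !mxE eqxx eq_sym; ring.
Qed.

Lemma derivable_mk_state (a e : R -> R) (b : R -> 'rV[R]_d) t :
  derivable a t 1 -> (forall j, derivable (fun s => b s 0 j) t 1) ->
  derivable e t 1 -> derivable (fun s => mk_state (a s) (b s) (e s)) t 1.
Proof.
move=> ha hb he; apply/derivable_mxP => z k; rewrite (ord1 z).
have [k'|k'] := splitP k => [ek|/= ek].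
  have -> : k = lshift (d + 1) k' by exact: val_inj.
  have e' s : mk_state (a s) (b s) (e s) 0 (lshift (d + 1) k') = a s.
    by rewrite row_mxEl !mxE !ord1 mulr1n.
  rewrite (funext e'); exact: ha.
have [j|j] := splitP k' => [ej|/= ej].
  have -> : k = rshift 1 (lshift 1 j) by apply: val_inj; rewrite /= ek ej.
  have e' s : mk_state (a s) (b s) (e s) 0 (rshift 1 (lshift 1 j)) = b s 0 j.
    by rewrite row_mxEr row_mxEl.
  rewrite (funext e'); exact: hb.
have -> : k = rshift 1 (rshift d j) by apply: val_inj; rewrite /= ek ej.
have e' s : mk_state (a s) (b s) (e s) 0 (rshift 1 (rshift d j)) = e s.
  by rewrite !row_mxEr !mxE !ord1 mulr1n.
rewrite (funext e'); exact: he.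
Qed.

Lemma is_derive_velocity (c : R -> 'rV[R]_(nvar d)) t j (dc := 'D_1 c t) :
  density (c t) != 0 -> derivable c t 1 ->
  is_derive t 1 (fun s => velocity (c s) 0 j)
    (momentum dc 0 j * (density (c t))^-1
     + momentum (c t) 0 j * - (density dc / density (c t) ^+ 2)).
Proof.
move=> r0 hc; under eq_fun do rewrite velocityE.
exact: is_derive_mul (is_derive_momentum j hc)
  (is_derive_inv (is_derive_density hc) r0).
Qed.

Lemma derivable_euler_flux (c : R -> 'rV[R]_(nvar d)) t i :
  density (c t) != 0 -> derivable c t 1 ->
  derivable (fun s => euler_flux i (c s)) t 1.
Proof.
move=> r0 hc.
have hr := is_derive_density hc; have he := is_derive_energy hc.
have hp := is_derive_pressure r0 hc.
have hV j := is_derive_velocity j r0 hc.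
apply: derivable_mk_state => [|j|].
- exact: (@ex_derive _ _ _ _ _ _ _ (is_derive_mul hr (hV i))).
- under eq_fun do rewrite mxE.
  exact: (@ex_derive _ _ _ _ _ _ _ (is_derive_add
    (is_derive_mul (is_derive_mul hr (hV i)) (hV j))
    (is_derive_mul (is_derive_const (i == j)%:R t) hp))).
- exact: (@ex_derive _ _ _ _ _ _ _
    (is_derive_mul (is_derive_add he hp) (hV i))).
Qed.

End FluxCurves.

Section Homogeneity.
Context {R : realType} {d : nat}.
Variable alpha : R.
Hypothesis alpha_range : 0 < alpha \/ alpha < - gamma.
Implicit Types (t : R) (u w : 'rV[R]_(nvar d)) (i : 'I_d).

Let alpha0 : alpha != 0. Proof. exact: alpha_neq0. Qed.
Let ag0 : alpha + gamma != 0. Proof. exact: alphaDgamma_neq0. Qed.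
Let b10 : beta alpha + 1 != 0. Proof. exact: betaD1_neq0. Qed.
Let g10 : gamma - 1 != 0 :> R. Proof. by rewrite gt_eqF ?gammaB1_gt0. Qed.

Lemma is_derive_temperature_of_var (c : R -> 'rV[R]_(nvar d)) t
    (dc := 'D_1 c t) :
  energy (c t) != 0 -> derivable c t 1 ->
  is_derive t 1 (fun s => temperature_of_var alpha (c s))
    ((gamma - 1) / alpha *
     (density dc / energy (c t)
      - density (c t) * energy dc / energy (c t) ^+ 2
      - dotv (momentum (c t)) (momentum dc) / energy (c t) ^+ 2
      + dotv (momentum (c t)) (momentum (c t)) * energy dc
        / energy (c t) ^+ 3)).
Proof.
move=> e0 hc.
have hr := is_derive_density hc; have he := is_derive_energy hc.
have hm i := is_derive_momentum i hc.
have hmm := is_derive_dotv hm hm.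
have hi := is_derive_inv he e0.
have h := is_derive_mul (is_derive_const ((gamma - 1) / alpha) t)
  (is_derive_add (is_derive_mul hr hi)
   (is_derive_mul (is_derive_mul (is_derive_const (- 2^-1) t) hmm)
     (is_derive_mul hi hi))).
rewrite /temperature_of_var.
under eq_fun do rewrite -!mulNr expr2 invfM.
apply: (@is_derive_eq _ _ _ _ _ _ _ _ h).
rewrite -/dc (dotvC (momentum dc)).
by field; rewrite alpha0 e0.
Qed.

Lemma near_var_region (c : R -> 'rV[R]_(nvar d)) t : derivable c t 1 ->
  var_region alpha (c t) -> \forall s \near t, var_region alpha (c s).
Proof.
move=> hc [e0 th0]; have e00 : energy (c t) != 0 by rewrite lt_eqF.
have h1 := is_derive_gt0 (is_derive_temperature_of_var e00 hc) th0.
have := is_derive_gt0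
  (is_derive_mul (is_derive_const (-1) t) (is_derive_energy hc)).
rewrite mulN1r oppr_gt0 => /(_ e0).
by apply: filterS2 h1 => s ?; rewrite mulN1r oppr_gt0.
Qed.

(** The gradient of the pressure with respect to the entropy variables is
    [(rho, rho V, e + p) / z1], where [z1 = - energy w]. *)
Lemma is_derive_pressure_of_var (c : R -> 'rV[R]_(nvar d)) t (dc := 'D_1 c t)
    (u := state_of_var alpha (c t)) :
  var_region alpha (c t) -> derivable c t 1 ->
  is_derive t 1 (fun s => pressure_of_var alpha (c s))
    ((density u * density dc + dotv (momentum u) (momentum dc)
      + (energy u + pressure u) * energy dc) / (- energy (c t))).
Proof.
move=> hw hc; have [e0 th0] := hw.
have e00 : energy (c t) != 0 by rewrite lt_eqF.
have ne0 : 0 < - energy (c t) by rewrite oppr_gt0.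
have hN : is_derive t 1 (fun s => - energy (c s)) (- energy dc).
  exact: is_deriveN (is_derive_energy hc).
have h := is_derive_mul
  (is_derive_powR (- alpha / (gamma - 1))
     (is_derive_temperature_of_var e00 hc) th0)
  (is_derive_powR (- (alpha + gamma) / (gamma - 1)) hN ne0).
rewrite /pressure_of_var; apply: (@is_derive_eq _ _ _ _ _ _ _ _ h).
rewrite -/dc /u pressure_state_of_var// !mk_stateK.
have th00 : temperature_of_var alpha (c t) != 0 by rewrite gt_eqF.
have er : density_of_var alpha (c t) =
    pressure_of_var alpha (c t) / temperature_of_var alpha (c t).
  by rewrite pressure_of_varE// mulfK.
rewrite er /pressure_of_var /velocity_of_var !(dotvZl, dotvZr).
set P1 := _ `^ _; set P2 := _ `^ _.
have ew : density (c t) = energy (c t) *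
   (alpha / (gamma - 1) * temperature_of_var alpha (c t)
    + 2^-1 * dotv (momentum (c t)) (momentum (c t)) / energy (c t) ^+ 2).
  by rewrite {1}/temperature_of_var; field; rewrite e00 alpha0 g10.
rewrite ew; field.
by rewrite e00 alpha0 g10 th00.
Qed.

Lemma derivable_state_of_var (c : R -> 'rV[R]_(nvar d)) t :
  var_region alpha (c t) -> derivable c t 1 ->
  derivable (fun s => state_of_var alpha (c s)) t 1.
Proof.
move=> hw hc; have [e0 th0] := hw.
have e00 : energy (c t) != 0 by rewrite lt_eqF.
have ne0 : 0 < - energy (c t) by rewrite oppr_gt0.
have hN : is_derive t 1 (fun s => - energy (c s)) (- energy ('D_1 c t)).
  exact: is_deriveN (is_derive_energy hc).
have hth := is_derive_temperature_of_var e00 hc.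
have hr := is_derive_mul
  (is_derive_powR ((1 - alpha - gamma) / (gamma - 1)) hth th0)
  (is_derive_powR (- (alpha + gamma) / (gamma - 1)) hN ne0).
have hV j : is_derive t 1 (fun s => velocity_of_var (c s) 0 j) 
    ('D_1 (fun s => velocity_of_var (c s)) t 0 j).
  apply: is_derive_coord; apply/derivable_mxP => z k; rewrite (ord1 z).
  under eq_fun do rewrite mxE.
  exact: (@ex_derive _ _ _ _ _ _ _
    (is_derive_mul (is_derive_inv hN (lt0r_neq0 ne0))
       (is_derive_momentum k hc))).
have hp := is_derive_pressure_of_var hw hc.
apply: derivable_mk_state => [|j|].
- exact: (@ex_derive _ _ _ _ _ _ _ hr).
- under eq_fun do rewrite mxE.
  exact: (@ex_derive _ _ _ _ _ _ _ (is_derive_mul hr (hV j))).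
- exact: (@ex_derive _ _ _ _ _ _ _
    (is_derive_add (is_derive_mul hp (is_derive_const (gamma - 1)^-1 t))
      (is_derive_mul (is_derive_mul (is_derive_const 2^-1 t) hr)
        (is_derive_dotv hV hV)))).
Qed.

Definition potential_of_var i w : R := momentum w 0 i * pressure_of_var alpha w.

(** The flux is the gradient of the potential: [potential_of_var] is
    [w_(i+1) * p], and since [w_(i+1) / z1 = V_i] the gradient of [p] gives
    everything but the pressure term of the momentum flux. *)
Lemma is_derive_potential_of_var (c : R -> 'rV[R]_(nvar d)) t i :
  var_region alpha (c t) -> derivable c t 1 ->
  is_derive t 1 (fun s => potential_of_var i (c s))
    (dotv (euler_flux i (state_of_var alpha (c t))) ('D_1 c t)).
Proof.
move=> hw hc; have [e0 th0] := hw.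
have e00 : energy (c t) != 0 by rewrite lt_eqF.
have h := is_derive_mul (is_derive_momentum i hc)
            (is_derive_pressure_of_var hw hc).
apply: (@is_derive_eq _ _ _ _ _ _ _ _ h).
set u := state_of_var _ _; set dc := 'D_1 c t.
have eV : velocity u = velocity_of_var (c t) by exact: velocity_state_of_var.
have ep : pressure u = pressure_of_var alpha (c t).
  exact: pressure_state_of_var.
have em : momentum u = density u *: velocity u.
  by rewrite eV /u !mk_stateK.
have eVi : velocity u 0 i = momentum (c t) 0 i / - energy (c t).
  by rewrite eV mxE mulrC.
rewrite dotv_euler_flux em dotvZl -ep eVi.
by field; rewrite e00.
Qed.

(** Euler's relation for the potential, which is homogeneous of degree
    [beta + 1] in the entropy variables and has gradient the flux. *)
Lemma entropy_var_dot_flux i u : admissible u ->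
  dotv (explicit_entropy_var alpha u) (euler_flux i u) =
  (beta alpha + 1) * potential alpha i u.
Proof.
move=> [r0 p0]; have r00 : density u != 0 by rewrite gt_eqF.
rewrite /potential dotvC dotv_euler_flux !mk_stateK dotvZr.
rewrite [(_ *: velocity u) 0 i]mxE.
have -> : energy u = pressure u / (gamma - 1)
     + 2^-1 * density u * dotv (velocity u) (velocity u).
  by rewrite /pressure; field.
rewrite /temperature /beta; field.
by rewrite r00 g10.
Qed.

Lemma potential_explicit i u : admissible u ->
  potential_of_var i (explicit_entropy_var alpha u) = potential alpha i u.
Proof.
move=> hu; rewrite /potential /potential_of_var !mk_stateK mxE.
rewrite -pressure_state_of_var; last exact: var_region_explicit.
by rewrite explicit_entropy_varK.
Qed.

Lemma dot_flux_of_var i w : var_region alpha w ->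
  dotv w (euler_flux i (state_of_var alpha w)) =
  (beta alpha + 1) * potential_of_var i w.
Proof.
move=> hw; have hu := admissible_state_of_var hw.
rewrite -{1 3}(explicit_entropy_var_state_of_var alpha_range hw).
by rewrite entropy_var_dot_flux// potential_explicit.
Qed.

(** On the line [w + s e_k], differentiate at [s = 0] the identity
    [w . F = (beta + 1) psi]. The product rule gives [F_k + (W^T A)_k] on the
    left and [(beta + 1) F_k] on the right. *)
Lemma Atilde_homogeneous i u (x : 'rV[R]_(nvar d)) : admissible u ->
  \sum_b entropy_var alpha u 0 b * \sum_c Atilde alpha i u b c * x 0 c =
  beta alpha * dotv (euler_flux i u) x.
Proof.
move=> hu; have uw := explicit_entropy_varK alpha_range hu.
have hw := var_region_explicit alpha_range hu.
under eq_bigr do rewrite mulr_sumr.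
rewrite exchange_big mulr_sumr; apply: eq_bigr => k _.
under eq_bigr do rewrite mulrA.
rewrite -mulr_suml mulrA; congr (_ * _).
rewrite entropy_varE//; set w := explicit_entropy_var alpha u in uw hw *.
pose c (s : R) : 'rV[R]_(nvar d) := s *: delta_mx 0 k + w.
have c0 : c 0 = w by rewrite /c scale0r add0r.
have hc : is_derive (0 : R) 1 c (delta_mx 0 k : 'rV[R]_(nvar d)).
  exact: is_derive_line.
have dc : derivable c 0 1 by exact: ex_derive.
have Dc : 'D_1 c 0 = delta_mx 0 k by exact: derive_val.
have hwc : var_region alpha (c 0) by rewrite c0.
have near_c := near_var_region dc hwc.
pose f s := euler_flux i (state_of_var alpha (c s)).
have df : derivable f 0 1.
  apply: (@derivable_euler_flux _ _ (fun s => state_of_var alpha (c s))).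
    by rewrite density_state_of_var gt_eqF ?density_of_var_gt0.
  exact: derivable_state_of_var.
have ef b : Atilde alpha i u b k = 'D_1 f 0 0 b.
  rewrite mxE derive_along_line (derive_mx df) [RHS]mxE (entropy_varE ag0 hu).
  apply: near_eq_derive; apply: filterS near_c => s hs.
  by rewrite state_of_entropy_varE.
have h1 := is_derive_dotv (fun b => is_derive_coord b dc)
                          (fun b => is_derive_coord b df).
have h2 := is_derive_mul (is_derive_const (beta alpha + 1) 0)
             (is_derive_potential_of_var i hwc dc).
have : 'D_1 (fun s => dotv (c s) (f s)) 0 =
       'D_1 (fun s => (beta alpha + 1) * potential_of_var i (c s)) 0.
  apply: near_eq_derive; apply: filterS near_c => s hs.
  exact: dot_flux_of_var.
rewrite (@derive_val _ _ _ _ _ _ _ h1) (@derive_val _ _ _ _ _ _ _ h2).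
rewrite Dc /f c0 uw dotvC !dotv_delta mul0r add0r mulrDl mul1r [LHS]addrC.
move/addIr => <-; apply: eq_bigr => b _.
by rewrite ef.
Qed.

End Homogeneity.

(** * Tadmor's condition for the two-point flux *)

Section ExponentMean.
Context {R : realType}.
Implicit Types s a b : R.

Lemma meanC a b : mean a b = mean b a.
Proof. by rewrite /mean addrC. Qed.

Lemma exp_meanC s a b : exp_mean s a b = exp_mean s b a.
Proof.
rewrite /exp_mean eq_sym; case: eqVneq => [->//|_].
by rewrite -opprB -[a - b]opprB mulrN invrN mulrNN.
Qed.

(** Exponential means enter Tadmor's condition as exact divided differences of
    powers; this form covers the diagonal as well. *)
Lemma exp_meanM s a b : s + 1 != 0 ->
  exp_mean s a b * (a - b) = (a `^ (s + 1) - b `^ (s + 1)) / (s + 1).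
Proof.
move=> s0; rewrite /exp_mean; case: eqVneq => [->|ab].
  by rewrite !subrr mulr0 mul0r.
by field; rewrite s0 subr_eq0.
Qed.

Lemma exp_mean_neq0 s a b : s + 1 != 0 -> 0 < a -> 0 < b ->
  exp_mean s a b != 0.
Proof.
move=> s0 a0 b0; rewrite /exp_mean; have [_|ab] := eqVneq a b.
  by rewrite gt_eqF ?powR_gt0.
rewrite mulf_neq0 ?invr_eq0 ?mulf_neq0 ?subr_eq0//.
apply: contra_neq ab => /(congr1 (@ln R)); rewrite !ln_powR => /(mulfI s0).
by apply: ln_inj; rewrite posrE.
Qed.

End ExponentMean.

Section Tadmor.
Context {R : realType} {d : nat}.
Variable alpha : R.
Hypothesis alpha_range : 0 < alpha \/ alpha < - gamma.
Implicit Types (u v x : 'rV[R]_(nvar d)) (i : 'I_d).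

Let alpha0 : alpha != 0. Proof. exact: alpha_neq0. Qed.
Let ag0 : alpha + gamma != 0. Proof. exact: alphaDgamma_neq0. Qed.
Let g10 : gamma - 1 != 0 :> R. Proof. by rewrite gt_eqF ?gammaB1_gt0. Qed.
Let g0 : gamma != 0 :> R. Proof. by rewrite /gamma; apply/eqP; lra. Qed.

Lemma sy_fluxC i u v : sy_flux alpha i u v = sy_flux alpha i v u.
Proof.
rewrite /sy_flux /=.
move: (zvar1 alpha u) (zvar1 alpha v) (velocity u) (velocity v)
  (pressure u) (pressure v) => q q' V V' p p'.
set f := _ / _; set f' := mean (q' * V' 0 i) _ / _.
have -> : f = f'.
  by congr (_ / (_ * _)); [exact: meanC|exact: meanC|exact: exp_meanC].
congr mk_state.
  by apply/rowP => j; rewrite !mxE; congr (_ * _ + _ * _); exact: meanC.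
rewrite [exp_mean _ q _]exp_meanC [mean (\sum_j _) _]meanC.
rewrite [mean (p `^ _) _]meanC.
have -> : \sum_j mean (V 0 j) (V' 0 j) ^+ 2 = \sum_j mean (V' 0 j) (V 0 j) ^+ 2.
  by apply: eq_bigr => j _; rewrite [mean (V 0 j) _]meanC.
reflexivity.
Qed.

(** Expresses [z1 * T], hence the first entropy variable, by powers of [p] and
    [z1], the two quantities whose powers are averaged in the flux. *)
Lemma zvar1_temperature u : admissible u ->
  zvar1 alpha u * temperature u =
  pressure u `^ (- (gamma - 1) / alpha) * zvar1 alpha u `^ (- gamma / alpha).
Proof.
move=> hu; have [r0 p0] := hu; have q0 := zvar1_gt0 alpha hu.
have T0 := temperature_gt0 hu.
have lT := ln_temperature hu; have lq := ln_zvar1 alpha hu.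
move: (density u) (pressure u) (temperature u) (zvar1 alpha u)
  r0 p0 T0 q0 lT lq => r p T q r0 p0 T0 q0 lT lq.
apply: ln_inj; [by rewrite posrE mulr_gt0|by rewrite posrE mulr_gt0 ?powR_gt0|].
rewrite [LHS]lnM ?posrE// [RHS]lnM ?posrE ?powR_gt0// ln_powR ln_powR lT lq.
by field; rewrite alpha0 ag0.
Qed.

(** Here [a = p^(- (gamma - 1) / alpha)], [b = z1^(- gamma / alpha)], [q = z1]
    and [v = V_i], at the two states, [Vkl] are the dot products of the
    velocities, and [Ep], [Eq] are the exponential means. Use the product rule
    [[ab] = {b}[a] + {a}[b]]
    for jumps and arithmetic means. The jump of [b] cancels the enthalpy part
    of the energy flux; the jump of [a] gives [f {b} Ep [p] = {q v}[p]] by the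
    choice of [f]; the kinetic terms cancel; and [{q v}[p] + [q v]{p}] is the
    jump of [q v p]. *)
Lemma tadmor_algebra (a1 a2 b1 b2 p1 p2 q1 q2 Ep Eq f V11 V12 V22 v1 v2 : R) :
  a1 - a2 = (1 - gamma) / alpha * (Ep * (p1 - p2)) ->
  b1 - b2 = - gamma / alpha * (Eq * (q1 - q2)) ->
  f * (mean b1 b2 * Ep) = mean (q1 * v1) (q2 * v2) ->
  f * ((- (alpha / (gamma - 1)) * (a1 * b1) - 2^-1 * (q1 * V11))
       - (- (alpha / (gamma - 1)) * (a2 * b2) - 2^-1 * (q2 * V22)))
  + f * (2^-1 * (q1 * V11 - q2 * V12 + (q1 * V12 - q2 * V22)))
  + mean p1 p2 * (q1 * v1 - q2 * v2)
  - (q1 - q2) * (f * (gamma / (gamma - 1) * mean a1 a2 * Eq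
       + 4^-1 * (V11 + V12 + (V12 + V22)) - 2^-1 * mean V11 V22))
  = q1 * v1 * p1 - q2 * v2 * p2.
Proof.
move=> ha hb hf.
have K : - (alpha / (gamma - 1)) * (a1 * b1 - a2 * b2) =
    mean b1 b2 * Ep * (p1 - p2)
    + gamma / (gamma - 1) * mean a1 a2 * Eq * (q1 - q2).
  have -> : a1 * b1 - a2 * b2 = mean b1 b2 * (a1 - a2) + mean a1 a2 * (b1 - b2).
    by rewrite /mean; field.
  by rewrite ha hb; field; rewrite alpha0 g10.
transitivity (f * (- (alpha / (gamma - 1)) * (a1 * b1 - a2 * b2)
    - gamma / (gamma - 1) * mean a1 a2 * Eq * (q1 - q2))
  + mean p1 p2 * (q1 * v1 - q2 * v2)).
  by rewrite /mean; field; exact: g10.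
rewrite K.
transitivity (f * (mean b1 b2 * Ep) * (p1 - p2)
              + mean p1 p2 * (q1 * v1 - q2 * v2)).
  by ring.
by rewrite hf /mean; field.
Qed.

Lemma sum_sqr_dotv n (x : 'rV[R]_n) : \sum_j x 0 j ^+ 2 = dotv x x.
Proof. by apply: eq_bigr => j _; rewrite expr2. Qed.

Lemma dotv_sub_mk_state (x1 x2 y1 y2 a c : R) (x y b : 'rV[R]_d) :
  dotv (mk_state x1 x x2 - mk_state y1 y y2) (mk_state a b c) =
  (x1 - y1) * a + dotv (x - y) b + (x2 - y2) * c.
Proof.
rewrite dotvDl dotvNl !dotv_state !density_mk !momentum_mk !energy_mk.
by rewrite dotvDl dotvNl; ring.
Qed.

Lemma tadmor i u v : admissible u -> admissible v ->
  dotv (explicit_entropy_var alpha u - explicit_entropy_var alpha v)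
       (sy_flux alpha i u v) =
  potential alpha i u - potential alpha i v.
Proof.
move=> hu hv; have [_ p0] := hu; have [_ p'0] := hv.
have q0 := zvar1_gt0 alpha hu; have q'0 := zvar1_gt0 alpha hv.
have th := zvar1_temperature hu; have th' := zvar1_temperature hv.
rewrite /potential /explicit_entropy_var /sy_flux dotv_sub_mk_state; lazy zeta.
move: (zvar1 alpha u) (zvar1 alpha v) (velocity u) (velocity v)
  (pressure u) (pressure v) (temperature u) (temperature v)
  q0 q'0 p0 p'0 th th' => q q' V V' p p' T T' q0 q'0 p0 p'0 th th' {hu hv}.
have e1 : (1 - gamma - alpha) / alpha + 1 = - (gamma - 1) / alpha by field.
have e2 : - (gamma + alpha) / alpha + 1 = - gamma / alpha by field.
have n1 : (1 - gamma - alpha) / alpha + 1 != 0.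
  by rewrite e1 mulf_neq0 ?oppr_eq0 ?invr_eq0.
have n2 : - (gamma + alpha) / alpha + 1 != 0.
  by rewrite e2 mulf_neq0 ?oppr_eq0 ?invr_eq0.
have Ep0 := exp_mean_neq0 n1 p0 p'0.
have ha := exp_meanM p p' n1; have hb := exp_meanM q q' n2.
rewrite {}e1 in ha; rewrite {}e2 in hb.
have B0 : mean (q `^ (- gamma / alpha)) (q' `^ (- gamma / alpha)) != 0.
  by rewrite gt_eqF// /mean divr_gt0// addr_gt0// powR_gt0.
set f := mean (q * V 0 i) _ / _.
have hf : f * (mean (q `^ (- gamma / alpha)) (q' `^ (- gamma / alpha)) *
   exp_mean ((1 - gamma - alpha) / alpha) p p') =
    mean (q * V 0 i) (q' * V' 0 i).
  by rewrite /f divfK// mulf_neq0.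
move: f (exp_mean _ p p') (exp_mean _ q q') {Ep0 B0} ha hb hf
  => f Ep Eq ha hb hf.
have {}ha : p `^ (- (gamma - 1) / alpha) - p' `^ (- (gamma - 1) / alpha) =
    (1 - gamma) / alpha * (Ep * (p - p')).
  by rewrite ha; field; rewrite alpha0 g10.
have {}hb : q `^ (- gamma / alpha) - q' `^ (- gamma / alpha) =
    - gamma / alpha * (Eq * (q - q')).
  by rewrite hb; field; rewrite alpha0 g0.
have K := @tadmor_algebra _ _ _ _ _ _ _ _ _ _ _
  (dotv V V) (dotv V V') (dotv V' V') _ _ ha hb hf.
rewrite -{}K -th -th' {hf th th' ha hb}.
have mV : \row_j mean (V 0 j) (V' 0 j) = 2^-1 *: (V + V').
  by apply/rowP => j; rewrite !mxE /mean mulrC.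
have -> : \row_j (f * mean (V 0 j) (V' 0 j) + (i == j)%:R * mean p p') =
          f *: (2^-1 *: (V + V')) + mean p p' *: delta_mx 0 i.
  apply/rowP => j; rewrite -mV !mxE eqxx [j == i]eq_sym.
  by congr (_ + _); rewrite mulrC.
rewrite !sum_sqr_dotv.
have -> : \sum_(j < d) mean (V 0 j) (V' 0 j) ^+ 2 =
    4^-1 * (dotv V V + dotv V V' + (dotv V V' + dotv V' V')).
  transitivity (\sum_(j < d) (\row_j mean (V 0 j) (V' 0 j)) 0 j ^+ 2).
    by apply: eq_bigr => j _; rewrite mxE.
  rewrite sum_sqr_dotv mV dotvZl dotvZr dotvDl !dotvDr.
  by rewrite (dotvC V' V); field.
rewrite dotvDl dotvNl !(dotvDr, dotvZr, dotvZl, dotv_delta) (dotvC V' V).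
by rewrite /mean; ring.
Qed.

End Tadmor.

(** * Operators on stacked nodal vectors *)

Section StackedVectors.
Context {R : realType} {d np : nat}.
Implicit Types (g h : 'I_np -> 'rV[R]_(nvar d)) (A B : 'M[R]_np).

Lemma sum_mxtens (m n : nat) (F : 'I_(m * n) -> R) :
  \sum_q F q = \sum_i \sum_j F (mxtens_index (i, j)).
Proof.
rewrite pair_bigA/= (reindex (@mxtens_index m n))/=.
  by apply: eq_bigr => -[].
exists (@mxtens_unindex m n) => q _; first exact: mxtens_indexK.
exact: mxtens_unindexK.
Qed.

Lemma stackE g m b : stack g (mxtens_index (m, b)) 0 = g m 0 b.
Proof. by rewrite mxE mxtens_indexK. Qed.

Lemma stack_dot g h :
  ((stack g)^T *m stack h) 0 0 = \sum_m dotv (g m) (h m).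
Proof.
rewrite mxE sum_mxtens; apply: eq_bigr => m _; apply: eq_bigr => b _.
by rewrite mxE !stackE.
Qed.

Lemma kron_stack A g :
  kron A *m stack g = stack (fun m => \sum_n A m n *: g n).
Proof.
apply/colP => q; rewrite -(mxtens_unindexK q); case: (mxtens_unindex q) => m b.
rewrite stackE mxE sum_mxtens summxE; apply: eq_bigr => n _.
rewrite (bigD1 b)//= big1 ?addr0 => [|c cb]; rewrite tensmxE stackE !mxE.
  by rewrite eqxx mulr1.
by rewrite eq_sym (negbTE cb) mulr0 mul0r.
Qed.

Lemma kron_mul A B : kron A *m kron B = kron (d := d) (A *m B).
Proof. by rewrite /kron tensmx_mul mul1mx. Qed.

Lemma kron1 : kron (d := d) (1%:M : 'M[R]_np) = 1%:M.
Proof.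
apply/matrixP => q s; rewrite -(mxtens_unindexK q) -(mxtens_unindexK s).
case: (mxtens_unindex q) (mxtens_unindex s) => m b [n c].
by rewrite tensmxE !mxE -natrM mulnb (can_eq (@mxtens_indexK _ _)) xpair_eqE.
Qed.

Lemma kron_unit A : A \in unitmx -> kron (d := d) A \in unitmx.
Proof.
move=> hA; have := kron_mul A (invmx A).
by rewrite mulmxV// kron1 => /mulmx1_unit[].
Qed.

Lemma block_mx_of_stack (X : 'I_np -> 'I_np -> 'M[R]_(nvar d)) g :
  block_mx_of X *m stack g = stack (fun m => \sum_n g n *m (X m n)^T).
Proof.
apply/colP => q; rewrite -(mxtens_unindexK q); case: (mxtens_unindex q) => m b.
rewrite stackE mxE sum_mxtens summxE; apply: eq_bigr => n _.
rewrite mxE; apply: eq_bigr => c _.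
by rewrite stackE !mxE !mxtens_indexK mulrC.
Qed.

Lemma hadamard_kron_block A (X : 'I_np -> 'I_np -> 'rV[R]_(nvar d)) :
  hadamard (kron A) (block_mx_of (fun m n => 2 *: diag_mx (X m n)))
    *m const_mx 1 = stack (fun m => \sum_n (2 * A m n) *: X m n).
Proof.
apply/colP => q; rewrite -(mxtens_unindexK q); case: (mxtens_unindex q) => m b.
rewrite stackE mxE sum_mxtens summxE; apply: eq_bigr => n _.
rewrite (bigD1 b)//= big1 ?addr0 => [|c cb];
  rewrite !mxE !mxtens_indexK/= ?mxE.
  by rewrite eqxx !mulr1 mulr1n mulrCA mulrA.
by rewrite eq_sym (negbTE cb) mulr0 !mul0r.
Qed.

End StackedVectors.

Lemma derive1_col (R : realType) (n : nat) (c : 'I_n -> R -> R) (t : R) :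
  (forall m, derivable (c m) t 1) ->
  derive1 (fun s => \col_m c m s) t = \col_m 'D_1 (c m) t.
Proof.
move=> hc; rewrite derive1E.
have e m z : (fun s => (\col_m' c m' s) m z) = c m.
  by apply/funext => s; rewrite mxE.
have dcol : derivable (fun s => \col_m c m s) t 1.
  by apply/derivable_mxP => m z; rewrite e; exact: hc.
by rewrite (derive_mx dcol); apply/colP => m; rewrite [LHS]mxE e mxE.
Qed.

Lemma derive1_stack (R : realType) (d np : nat)
    (c : 'I_np -> R -> 'rV[R]_(nvar d)) (t : R) :
  (forall m, derivable (c m) t 1) ->
  derive1 (fun s => stack (fun m => c m s)) t = stack (fun m => 'D_1 (c m) t).
Proof.
move=> hc; rewrite derive1_col => [|q].
  by apply/colP => q; rewrite !mxE (derive_mx (hc _)) mxE.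
exact: (@ex_derive _ _ _ _ _ _ _ (is_derive_coord _ (hc _))).
Qed.

(** * Facet operators *)

Section FacetOperators.
Context {R : realType} {d nfac np nf : nat} {K : finType}.
Variables (M : mesh R d nfac K) (ops : sbp_data R d nfac np nf K).
Implicit Types (f g : K * 'I_nfac) (i : 'I_d).

Definition facet_coef f i (j : 'I_nf) : R :=
  facet_weight ops f 0 j *
  normal M f (node ops f.1 (facet_node ops f j)) 0 i.

(** With [g = f] this is [E^{kk}] and with [g = nbr M f] it is [E^{kv}]. Only
    pairs formed by corresponding facet nodes contribute, because the facet
    nodes are volume nodes and the weights and normals are diagonal. *)
Lemma sum_facet_operator f g i (X : 'I_np -> 'I_np -> R) :
  \sum_m \sum_n
    ((Rmx ops f)^T *m Bmx ops f *m Nmx M ops f i *m Rmx ops g) m n * X m n =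
  \sum_j facet_coef f i j * X (facet_node ops f j) (facet_node ops g j).
Proof.
have e m n :
    ((Rmx ops f)^T *m Bmx ops f *m Nmx M ops f i *m Rmx ops g) m n =
    \sum_j facet_coef f i j *
      ((m == facet_node ops f j)%:R * (n == facet_node ops g j)%:R).
  rewrite mxE; apply: eq_bigr => j _.
  rewrite /Bmx /Nmx !mul_mx_diag !mxE /facet_coef; ring.
under eq_bigr => m _ do under eq_bigr => n _ do rewrite e mulr_suml.
under eq_bigr => m _ do rewrite exchange_big/=.
rewrite exchange_big/=; apply: eq_bigr => j _.
rewrite (bigD1 (facet_node ops f j))//= [X in _ + X]big1 ?addr0 => [|m hm].
  rewrite (bigD1 (facet_node ops g j))//= big1 ?addr0 => [|n hn].
    by rewrite !eqxx !mulr1.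
  by rewrite (negbTE hn) !mulr0 mul0r.
by apply: big1 => n _; rewrite (negbTE hm) mul0r mulr0 mul0r.
Qed.

End FacetOperators.

(** * Entropy balance on an element and over the mesh *)

Section Balance.
Context {R : realType} {d nfac np nf : nat} {K : finType}.
Variable alpha : R.
Hypothesis alpha_range : 0 < alpha \/ alpha < - gamma.
Variables (M : mesh R d nfac K) (ops : sbp_data R d nfac np nf K).
Implicit Types (f : K * 'I_nfac) (k : K) (i : 'I_d).

(** The entropy that the element [f.1] gains through the facet [f], see
    [element_balance]. *)
Definition facet_production (U : K -> 'I_np -> 'rV[R]_(nvar d)) f : R :=
  \sum_(i < d) \sum_(j < nf)
    let v := U f.1 (facet_node ops f j) in
    let v' := U (nbr M f).1 (facet_node ops (nbr M f) j) in
    facet_coef M ops f i j *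
    (potential alpha i v
     - dotv (explicit_entropy_var alpha v) (sy_flux alpha i v v')).

(** The coefficients on the two sides of a facet are opposite, and by symmetry
    the two-point flux is the same; the two potential defects then agree by
    Tadmor's condition. *)
Lemma facet_production_nbr U f pgeom p r :
  is_periodic_mesh M pgeom -> is_sbp M ops p r ->
  (forall k m, admissible (U k m)) ->
  facet_production U (nbr M f) = - facet_production U f.
Proof.
have alg (c a b x y : R) : a - b = x - y -> - c * (y - b) = - (c * (x - a)).
  by move=> e; rewrite mulNr (_ : y - b = x - a)//; lra.
move=> hM hO hU; rewrite /facet_production -sumrN; apply: eq_bigr => i _.
rewrite -sumrN; apply: eq_bigr => j _ /=.
rewrite (nbr_involutive hM).
have -> : facet_coef M ops (nbr M f) i j = - facet_coef M ops f i j.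
  rewrite /facet_coef (facet_weight_nbr hO) -mulrN; congr (_ * _).
  have h := normal_opposite hM (facet_node_in hO f j).
  rewrite {1}(facet_node_match hO) addrK in h.
  by rewrite h mxE.
have ht := tadmor alpha_range i (hU f.1 (facet_node ops f j))
             (hU (nbr M f).1 (facet_node ops (nbr M f) j)).
rewrite dotvDl dotvNl in ht.
rewrite [sy_flux alpha i (U (nbr M f).1 _) _]sy_fluxC.
exact: alg ht.
Qed.

Lemma sum_facet_production U pgeom p r :
  is_periodic_mesh M pgeom -> is_sbp M ops p r ->
  (forall k m, admissible (U k m)) ->
  \sum_f facet_production U f = 0.
Proof.
move=> hM hO hU; set S := \sum_f _.
have e : S = - S.
  rewrite {1}/S (reindex_inj (inv_inj (nbr_involutive hM))) -sumrN.
  by apply: eq_bigr => f _; exact: facet_production_nbr hM hO hU.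
by clearbody S; lra.
Qed.

Lemma Hmx_unit p r k : is_sbp M ops p r -> Hmx ops k \in unitmx.
Proof.
move=> hO; have /is_diag_mxP hd := Hmx_diag hO k.
have -> : Hmx ops k = diag_mx (\row_m Hmx ops k m m).
  apply/matrixP => m n; rewrite !mxE; case: eqVneq => [->|mn].
    by rewrite mulr1n.
  by rewrite mulr0n hd.
rewrite unitmxE det_diag unitfE; apply/prodf_neq0 => m _.
by rewrite mxE gt_eqF ?(Hmx_pos hO).
Qed.

Lemma Atilde_mx_stack i (V g : 'I_np -> 'rV[R]_(nvar d)) :
  Atilde_mx alpha i V *m stack g =
  stack (fun m => g m *m (Atilde alpha i (V m))^T).
Proof.
rewrite block_mx_of_stack; congr stack; apply/funext => m.
rewrite (bigD1 m)//= eqxx big1 ?addr0// => n nm.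
by rewrite eq_sym (negbTE nm) trmx0 mulmx0.
Qed.

(** Semidiscrete entropy balance. The functional [l] of the proof is the
    pairing with the entropy variables, applied to the scheme multiplied by the
    quadrature matrix. *)
Lemma element_balance p r k (U : K -> 'I_np -> 'rV[R]_(nvar d))
    (dU : 'I_np -> 'rV[R]_(nvar d)) :
  let flux i := stack (fun m => euler_flux i (U k m)) in
  let w := stack (fun m => entropy_var alpha (U k m)) in
  let Hinv := invmx (kron (Hmx ops k)) in
  is_sbp M ops p r -> (forall k m, admissible (U k m)) ->
  stack dU
      + (beta alpha / (beta alpha + 1)) *:
          (\sum_(i < d) kron (Dmx M ops k i) *m flux i)
      + (1 / (beta alpha + 1)) *:
          (\sum_(i < d) Atilde_mx alpha i (U k) *m kron (Dmx M ops k i) *m w)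
      = Hinv *m (\sum_(i < d) kron (Emx M ops k i) *m flux i)
        - 2^-1 *: (Hinv *m (\sum_(a < nfac) \sum_(i < d)
            hadamard (kron (Ekv M ops (k, a) i))
                     (Fmx alpha i (U k) (U (nbr M (k, a)).1))
              *m const_mx 1)) ->
  \sum_m Hmx ops k m m * dotv (entropy_var alpha (U k m)) (dU m) =
  \sum_(a < nfac) facet_production U (k, a).
Proof.
move=> flux w Hinv hO hU scheme.
have uH := Hmx_unit k hO; have ukH := kron_unit (d := d) uH.
pose H := Hmx ops k.
pose l (X : 'cV[R]_(np * nvar d)) : R := (w^T *m X) 0 0.
have lD X Y : l (X + Y) = l X + l Y by rewrite /l mulmxDr mxE.
have lZ a X : l (a *: X) = a * l X by rewrite /l -scalemxAr mxE.
have lN X : l (- X) = - l X by rewrite /l mulmxN mxE.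
have lS (I : finType) (X : I -> 'cV_(np * nvar d)) :
    l (\sum_j X j) = \sum_j l (X j).
  by rewrite /l mulmx_sumr summxE.
pose W m := entropy_var alpha (U k m).
pose F i m := euler_flux i (U k m).
have HD i : H *m Dmx M ops k i = Qmx M ops k i.
  by rewrite /Dmx mulmxA mulmxV// mul1mx.
have Hm (g : 'I_np -> 'rV[R]_(nvar d)) :
    l (kron H *m stack g) = \sum_m H m m * dotv (W m) (g m).
  rewrite kron_stack /l stack_dot; apply: eq_bigr => m _.
  rewrite (bigD1 m)//= big1 ?addr0 ?dotvZr// => n nm.
  by rewrite (is_diag_mxP (Hmx_diag hO k)) 1?eq_sym// scale0r.
have lkron A i : l (kron A *m flux i) =
    \sum_m \sum_n A m n * dotv (W m) (F i n).
  rewrite kron_stack /l stack_dot; apply: eq_bigr => m _.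
  by rewrite dotvC dotv_suml; apply: eq_bigr => n _; rewrite dotvZl dotvC.
have lvol i : l (kron H *m (kron (Dmx M ops k i) *m flux i)) =
    \sum_m \sum_n Qmx M ops k i m n * dotv (W m) (F i n).
  by rewrite mulmxA kron_mul HD lkron.
(* W^T A = beta F^T replaces the Jacobian by the flux; H commutes with the block
   diagonal Jacobian because it is diagonal. *)
have lsplit i :
    l (kron H *m (Atilde_mx alpha i (U k) *m kron (Dmx M ops k i) *m w)) =
    beta alpha * \sum_m \sum_n Qmx M ops k i n m * dotv (W m) (F i n).
  rewrite -mulmxA kron_stack Atilde_mx_stack Hm [in RHS]exchange_big mulr_sumr.
  apply: eq_bigr => m _ /=.
  pose g := \sum_n Dmx M ops k i m n *: W n.
  transitivity (H m m * (beta alpha * dotv (F i m) g)).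
    congr (_ * _).
    rewrite -(Atilde_homogeneous alpha_range i g (hU k m)).
    apply: eq_bigr => b _; congr (_ * _); rewrite mxE.
    by apply: eq_bigr => c _; rewrite mxE mulrC.
  rewrite mulrCA; congr (_ * _); rewrite dotvC dotv_suml mulr_sumr.
  apply: eq_bigr => n _; rewrite dotvZl mulrA -HD; congr (_ * _).
  rewrite [RHS]mxE (bigD1 m)//= big1 ?addr0// => n' nm.
  by rewrite (is_diag_mxP (Hmx_diag hO k)) 1?eq_sym// mul0r.
have lE i : l (kron (Emx M ops k i) *m flux i) =
    \sum_(a < nfac) \sum_j facet_coef M ops (k, a) i j *
       dotv (W (facet_node ops (k, a) j)) (F i (facet_node ops (k, a) j)).
  rewrite lkron.
  transitivity (\sum_(a < nfac) \sum_m \sum_n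
     Ekk M ops (k, a) i m n * dotv (W m) (F i n)).
    rewrite [RHS]exchange_big; apply: eq_bigr => m _.
    rewrite [RHS]exchange_big; apply: eq_bigr => n _.
    by rewrite summxE mulr_suml.
  by apply: eq_bigr => a _; rewrite sum_facet_operator.
have lF a i : l (hadamard (kron (Ekv M ops (k, a) i))
                  (Fmx alpha i (U k) (U (nbr M (k, a)).1)) *m const_mx 1) =
    2 * \sum_j facet_coef M ops (k, a) i j *
       dotv (W (facet_node ops (k, a) j))
            (sy_flux alpha i (U k (facet_node ops (k, a) j))
               (U (nbr M (k, a)).1 (facet_node ops (nbr M (k, a)) j))).
  rewrite hadamard_kron_block /l stack_dot.
  rewrite -(sum_facet_operator M ops (k, a) (nbr M (k, a)) i (fun m n =>
    dotv (W m) (sy_flux alpha i (U k m) (U (nbr M (k, a)).1 n)))).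
  rewrite mulr_sumr; apply: eq_bigr => m _.
  rewrite mulr_sumr dotvC dotv_suml; apply: eq_bigr => n _.
  by rewrite dotvZl dotvC mulrA.
have lFa a : l (\sum_(i < d) hadamard (kron (Ekv M ops (k, a) i))
                  (Fmx alpha i (U k) (U (nbr M (k, a)).1)) *m const_mx 1) =
    2 * \sum_i \sum_j facet_coef M ops (k, a) i j *
       dotv (W (facet_node ops (k, a) j))
            (sy_flux alpha i (U k (facet_node ops (k, a) j))
               (U (nbr M (k, a)).1 (facet_node ops (nbr M (k, a)) j))).
  by rewrite lS mulr_sumr; apply: eq_bigr => i _.
(* The SBP property Q + Q^T = E, from the symmetry of E. *)
have QE i m n : Qmx M ops k i m n + Qmx M ops k i n m = Emx M ops k i m n.
  have hS : Smx ops k i n m = - Smx ops k i m n.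
    by have /matrixP/(_ m n) := Smx_skew hO k i; rewrite !mxE.
  have hE : Emx M ops k i n m = Emx M ops k i m n.
    suff /matrixP/(_ m n) : (Emx M ops k i)^T = Emx M ops k i by rewrite mxE.
    rewrite raddf_sum; apply: eq_bigr => a _.
    rewrite /= /Ekk !trmx_mul trmxK !tr_diag_mx !mulmxA; congr (_ *m _).
    by rewrite -!mulmxA; congr (_ *m _); rewrite diag_mxC.
  by rewrite !mxE hS hE; field.
(* V and V' are the volume terms w^T Q f and f^T Q w, e is w^T E f, and P is
   the contribution of the two-point fluxes. *)
have := congr1 (fun X => l (kron H *m X)) scheme.
rewrite /= !mulmxDr mulmxN -!scalemxAr !mulmxA mulmxV// !mul1mx.
rewrite !mulmx_sumr lD lD lD lN !lZ Hm !lS.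
rewrite (eq_bigr _ (fun i _ => lvol i)) (eq_bigr _ (fun i _ => lsplit i)).
rewrite (eq_bigr _ (fun i _ => lE i)) (eq_bigr _ (fun a _ => lFa a)).
rewrite -!mulr_sumr.
set A := \sum_m _; set V := \sum_i _; set V' := \sum_i _.
set e := \sum_i _; set P := \sum_a _ => hA.
have VE : V + V' = e.
  rewrite -big_split; apply: eq_bigr => i _ /=; rewrite -lE lkron -big_split.
  apply: eq_bigr => m _; rewrite -big_split; apply: eq_bigr => n _ /=.
  by rewrite -mulrDl QE.
have -> : \sum_(a < nfac) facet_production U (k, a) =
          (beta alpha + 1)^-1 * e - P.
  rewrite /e /P [X in _ = _ * X - _]exchange_big mulr_sumr -sumrB.
  apply: eq_bigr => a _.
  rewrite mulr_sumr -sumrB; apply: eq_bigr => i _.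
  rewrite mulr_sumr -sumrB; apply: eq_bigr => j _ /=.
  rewrite mulrBr; congr (_ - _); last first.
    by rewrite /W entropy_varE ?alphaDgamma_neq0.
  rewrite [RHS]mulrCA; congr (_ * _).
  rewrite /W entropy_varE ?alphaDgamma_neq0// entropy_var_dot_flux//.
  by rewrite mulKf// betaD1_neq0.
have b0 := betaD1_neq0 alpha_range.
have -> : A = e - 2^-1 * (2 * P) - beta alpha / (beta alpha + 1) * (V + V').
  by rewrite -hA; field; exact: b0.
by rewrite VE; field; exact: b0.
Qed.

End Balance.

Theorem theorem2 (R : realType) (d : nat) (hd : (1 <= d <= 3)%N)
    (alpha : R) (halpha : 0 < alpha \/ alpha < - gamma)
    (K : finType) (nfac np nf p r pgeom : nat)
    (hpgeom2 : d = 2%N -> (pgeom <= p + 1)%N)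
    (hpgeom3 : d = 3%N -> (pgeom <= p %/ 2 + 1)%N)
    (M : mesh R d nfac K) (hM : is_periodic_mesh M pgeom)
    (ops : sbp_data R d nfac np nf K) (hO : is_sbp M ops p r)
    (J : set R) (hJopen : open J) (hJint : is_interval J)
    (u : K -> 'I_np -> R -> 'rV[R]_(nvar d))
    (hadm : forall k m t, J t -> admissible (u k m t))
    (hsmooth : forall k m t, J t -> derivable (u k m) t 1)
    (hscheme : forall k t, J t ->
      let U v := fun m => u v m t in
      let flux i := stack (fun m => euler_flux i (U k m)) in
      let w := stack (fun m => entropy_var alpha (U k m)) in
      let Hinv := invmx (kron (Hmx ops k)) in
      derive1 (fun s => stack (fun m => u k m s)) t
      + (beta alpha / (beta alpha + 1)) *:
          (\sum_(i < d) kron (Dmx M ops k i) *m flux i)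
      + (1 / (beta alpha + 1)) *:
          (\sum_(i < d) Atilde_mx alpha i (U k) *m kron (Dmx M ops k i) *m w)
      = Hinv *m (\sum_(i < d) kron (Emx M ops k i) *m flux i)
        - 2^-1 *: (Hinv *m (\sum_(a < nfac) \sum_(i < d)
            hadamard (kron (Ekv M ops (k, a) i))
                     (Fmx alpha i (U k) (U (nbr M (k, a)).1))
              *m const_mx 1))) :
  forall t, J t ->
    \sum_(k : K)
      (const_mx 1 : 'rV[R]_np) *m Hmx ops k
        *m derive1 (fun s => \col_m entropy alpha (u k m s)) t = 0.
Proof.
move=> t Jt; pose U k m := u k m t.
have hU k m : admissible (U k m) by exact: hadm.
have ag0 := alphaDgamma_neq0 halpha.
have balance k : \sum_m Hmx ops k m m *
      dotv (entropy_var alpha (U k m)) ('D_1 (u k m) t) =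
    \sum_(a < nfac) facet_production alpha M ops U (k, a).
  apply: (element_balance halpha hO hU).
  rewrite -derive1_stack => [|m]; last exact: hsmooth.
  exact: hscheme.
apply/matrixP => z z'; rewrite !ord1 summxE [RHS]mxE.
transitivity (\sum_k \sum_(a < nfac) facet_production alpha M ops U (k, a));
  last first.
  rewrite pair_bigA -[RHS](sum_facet_production halpha hM hO hU).
  by apply: eq_bigr => -[].
apply: eq_bigr => k _; rewrite -balance.
have dS m : is_derive t 1 (fun s => entropy alpha (u k m s))
    (dotv (entropy_var alpha (U k m)) ('D_1 (u k m) t)).
  rewrite (entropy_varE ag0 (hU k m)).
  exact: (@is_derive_entropy R d alpha (u k m) t ag0 (hU k m)
            (hsmooth k m t Jt)).
rewrite derive1_col => [|m]; last exact: (@ex_derive _ _ _ _ _ _ _ (dS m)).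
rewrite mxE; apply: eq_bigr => m _.
rewrite [X in _ * X]mxE (@derive_val _ _ _ _ _ _ _ (dS m)); congr (_ * _).
rewrite mxE (bigD1 m)//= big1 ?addr0 ?mxE ?mul1r// => n nm.
by rewrite (is_diag_mxP (Hmx_diag hO k))// mulr0.
Qed.
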